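(* Neither the reflection arrangement $\mathcal{A}(G_{33})$ nor the reflection arrangement $\mathcal{A}(G_{34})$ is inductively free.
   Context: $G_{33}$ and $G_{34}$ denote the irreducible finite complex reflection groups with Shephard–Todd numbers 33 and 34, in their reflection representations: $G_{33}$ acts on $V=\mathbb{C}^5$ and has order $51840$; $G_{34}$ acts on $V=\mathbb{C}^6$ and has order $39191040$. A reflection is an element of finite order in $\operatorname{GL}(V)$, different from the identity, whose fixed space is a hyperplane (its reflecting hyperplane). For a finite complex reflection group $W\subseteq\operatorname{GL}(V)$ (a finite subgroup generated by reflections), the reflection arrangement $\mathcal{A}(W)$ is the set of reflecting hyperplanes of the elements of $W$ acting as reflections on $V$. A hyperplane arrangement $(\mathcal{A},V)$ is a finite collection $\mathcal{A}$ of linear hyperplanes in a finite-dimensional complex vector space $V=\mathbb{C}^\ell$. For $H\in\mathcal{A}$, the restriction of $\mathcal{A}$ to $H$ is the arrangement $(\mathcal{A}^H,H)$ in $H$ with $\mathcal{A}^H := \{H\cap H' \mid H'\in\mathcal{A}\setminus\{H\}\}$. Let $S=S(V^* )\cong\mathbb{C}[x_1,\dots,x_\ell]$, where $x_1,\dots,x_\ell$ is a basis of $V^*$, let $\operatorname{Der}(S)$ be the $S$-module of $\mathbb{C}$-derivations of $S$, and let $D_i=\partial/\partial x_i$. For each $H\in\mathcal{A}$ fix $\alpha_H\in V^*$ with $H=\ker\alpha_H$, and let $Q(\mathcal{A})=\prod_{H\in\mathcal{A}}\alpha_H$. Put $D(\mathcal{A}) := \{\theta\in\operatorname{Der}(S)\mid\theta(Q(\mathcal{A}))\in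 Q(\mathcal{A})S\}$. The arrangement $\mathcal{A}$ is free if $D(\mathcal{A})$ is a free $S$-module. In that case $D(\mathcal{A})$ has an $S$-basis of $\ell$ homogeneous derivations $\theta_1,\dots,\theta_\ell$, where $\theta=\sum_i f_iD_i$ is homogeneous of polynomial degree $p$ if every $f_i$ is homogeneous of degree $p$ (or zero); the multiset of polynomial degrees of $\theta_1,\dots,\theta_\ell$ does not depend on the choice of the basis and is called the multiset of exponents $\exp\mathcal{A}$. The class of inductively free arrangements is the smallest class of arrangements such that: (1) the empty arrangement in $\mathbb{C}^\ell$ is inductively free for every $\ell\ge 0$; (2) if there is $H\in\mathcal{A}$ such that both $\mathcal{A}\setminus\{H\}$ (in $V$) and $\mathcal{A}^H$ (in $H$) are inductively free (hence free) and $\exp\mathcal{A}^H\subseteq\exp(\mathcal{A}\setminus\{H\})$ as multisets, then $\mathcal{A}$ is inductively free. *)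

(* Defs.v *)
From HB Require Import structures.
From mathcomp Require Import all_boot all_order all_algebra.
From mathcomp Require Import finmap multiset.
From mathcomp Require cardinality.
From mathcomp Require Import mpoly.

Set Implicit Arguments.
Unset Strict Implicit.
Unset Printing Implicit Defensive.

Import GRing.Theory Num.Theory.

Local Open Scope ring_scope.

Section Arrangements.
Variables (K : fieldType) (V : vectType K).

Definition is_hyperplane (H : {vspace V}) : Prop := (\dim H).+1 = \dim {:V}.

Definition is_arrangement (A : {fset {vspace V}}) : Prop :=
  forall H, H \in A -> is_hyperplane H.

(* The members of A^H are subspaces of the vector space H itself: the preimage
   of H' under the inclusion of H into V is the intersection of H and H'. *)
Definition restriction (A : {fset {vspace V}}) (H : {vspace V}) :
    {fset {vspace (subvs_of H)}} :=
  [fset (linfun (vsval : subvs_of H -> V) @^-1: H')%VS | H' in (A `\ H)%fset]%fset.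

(* S(V^* ), identified with a polynomial ring by taking for the 'X_i the basis
   of V^* dual to vbasis {:V}. *)
Definition sym_alg := {mpoly K[\dim {:V}]}.

Definition lin_form (a : 'Hom(V, K^o)) : sym_alg :=
  \sum_(i < \dim {:V}) (a (vbasis {:V})`_i : K) *: 'X_i.

Definition defining_polynomial (A : {fset {vspace V}}) (Q : sym_alg) : Prop :=
  exists2 alpha : {vspace V} -> 'Hom(V, K^o),
    forall H, H \in A -> lker (alpha H) = H
  & Q = \prod_(H <- A) lin_form (alpha H).

Definition is_derivation (theta : sym_alg -> sym_alg) : Prop :=
  (forall (c : K) p q, theta (c *: p + q) = c *: theta p + theta q) /\
  (forall p q, theta (p * q) = theta p * q + p * theta q).

(* D(A); it does not depend on the choice of the linear forms, which are unique
   up to nonzero scalars. *)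
Definition log_derivation (A : {fset {vspace V}})
    (theta : sym_alg -> sym_alg) : Prop :=
  is_derivation theta /\
  exists2 Q, defining_polynomial A Q & exists g, theta Q = g * Q.

Definition homogeneous_derivation (p : nat) (theta : sym_alg -> sym_alg) : Prop :=
  exists2 f : 'I_(\dim {:V}) -> sym_alg,
    forall i, f i \is p.-homog
  & forall q, theta q = \sum_i f i * q^`M(i).

Definition log_basis (A : {fset {vspace V}})
    (theta : 'I_(\dim {:V}) -> sym_alg -> sym_alg) : Prop :=
  [/\ forall i, log_derivation A (theta i),
      forall eta, log_derivation A eta ->
        exists c : 'I_(\dim {:V}) -> sym_alg,
          forall q, eta q = \sum_i c i * theta i q
    & forall c : 'I_(\dim {:V}) -> sym_alg,
        (forall q, \sum_i c i * theta i q = 0) -> forall i, c i = 0].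

(* A is free and exp A = E. *)
Definition has_exponents (A : {fset {vspace V}}) (E : {mset nat}%mset) : Prop :=
  exists theta d, [/\ log_basis A theta,
    forall i, homogeneous_derivation (d i) (theta i)
  & E = seq_mset [seq d i | i : 'I_(\dim {:V})]].

End Arrangements.

Inductive inductively_free (K : fieldType) :
    forall V : vectType K, {fset {vspace V}} -> Prop :=
| inductively_free0 (V : vectType K) :
    inductively_free (fset0 : {fset {vspace V}})
| inductively_free_add (V : vectType K) (A : {fset {vspace V}})
      (H : {vspace V}) (E' E'' : {mset nat}%mset) :
    is_arrangement A -> H \in A ->
    inductively_free (A `\ H)%fset -> inductively_free (restriction A H) ->
    has_exponents (A `\ H)%fset E' -> has_exponents (restriction A H) E'' ->
    (E'' `<=` E')%mset ->
    inductively_free A.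

Section Reflections.
Variables (K : fieldType) (V : vectType K).

Definition is_reflection (g : 'End(V)) : Prop :=
  [/\ exists2 n, (0 < n)%N & forall v, iter n g v = v,
      g != \1%VF
    & is_hyperplane (fixedSpace g)].

(* The subgroup of GL(V) generated by a set X of invertible endomorphisms. *)
Inductive generated (X : 'End(V) -> Prop) : 'End(V) -> Prop :=
| generated_gen g : X g -> generated X g
| generated_id : generated X \1%VF
| generated_comp g h : generated X g -> generated X h -> generated X (g \o h)%VF
| generated_inv g : generated X g -> generated X (g^-1)%VF.

(* fset_set turns a finite set into an {fset _} (and an infinite one into
   fset0). *)
Definition reflection_arrangement (W : 'End(V) -> Prop) : {fset {vspace V}} :=
  cardinality.fset_set
    (fun H => exists g, [/\ W g, is_reflection g & H = fixedSpace g]).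

End Reflections.

Section ShephardTodd.
Variable C : numClosedFieldType.

Definition hermitian n (u v : 'rV[C]_n) : C := \sum_i u 0 i * (v 0 i)^*.

(* The unitary reflection of order 2 that maps a to - a. *)
Definition refl n (a : 'rV[C]_n) : 'End('rV[C]_n) :=
  linfun (fun v : 'rV[C]_n => v - (2 * hermitian v a / hermitian a a) *: a).

(* A primitive cube root of unity. *)
Definition omega : C := (- 1 + 'i * sqrtC 3) / 2.

(* G_34, of order 39191040, is generated by the imprimitive group G(3,3,6), whose
   reflections have the roots e_i - omega^k e_j, and by the reflection with root
   (1,1,1,1,1,1). Its 126 reflections are those with roots e_i - omega^k e_j and
   (1, omega^k_2, ..., omega^k_6), k_2 + ... + k_6 = 0 mod 3; this is the line
   system K_6 in the book of Lehrer and Taylor. *)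
Definition G34_root (a : 'rV[C]_6) : Prop :=
  (exists i j k, i != j /\ a = delta_mx 0 i - omega ^+ k *: delta_mx 0 j) \/ a = const_mx 1.

Definition G34 : 'End('rV[C]_6) -> Prop :=
  generated (fun g => exists2 a, G34_root a & g = refl a).

(* G_33, of order 51840, is the reflection group of the line system K_5, which
   consists of the 45 lines of K_6 orthogonal to e_0 - e_1. They span the
   hyperplane x_0 = x_1 of C^6, identified isometrically with C^5 by
   (x, x, x_2, ..., x_5) |-> (sqrt 2 x, x_2, ..., x_5). The roots
   e_i - omega^k e_j generate G(3,3,4) on the last four coordinates. *)
Definition G33_root (a : 'rV[C]_5) : Prop :=
  (exists i j k, [/\ i != 0, j != 0, i != j & a = delta_mx 0 i - omega ^+ k *: delta_mx 0 j]) \/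
  a = \row_i (if i == 0 then sqrtC 2 else 1).

Definition G33 : 'End('rV[C]_5) -> Prop :=
  generated (fun g => exists2 a, G33_root a & g = refl a).

End ShephardTodd.

(* Main.v *)
From HB Require Import structures.
Require Import Defs.
From mathcomp Require Import all_boot all_order all_algebra.
From mathcomp Require Import perm finmap multiset.
From mathcomp Require boolp cardinality.
From mathcomp Require Import mpoly complex reals.
From Stdlib Require Import ZArith.
From mathcomp Require Import ring ssrZ zify.

Delimit Scope nat_scope with N.

(** Suppose that A is the reflection arrangement of G_33 or G_34 and that A is
    inductively free, with H the last hyperplane added.  The exponents of a
    free arrangement add up to the number of its hyperplanes, so
    exp (A \ H) consists of exp (A^H) and of the number |A \ H| - |A^H|.  This
    number is 44 - 28 = 16 for G_33 and 125 - 85 = 40 for G_34.  But D(A \ H)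
    contains D(A), and D(A) contains a full set of independent homogeneous
    derivations of degrees 1, 7, 9, 13, 15 (for G_33) or 1, 13, 19, 25, 31, 37
    (for G_34).  A homogeneous element of D(A \ H) whose degree is less than
    that of the last basis element is, at every point, a linear combination of
    the other basis elements; there is one too few of them for the values of
    these derivations to be independent anywhere
    ([small_degrees_dependent], [not_inductively_free]).

    The low degree derivations are the vector fields
      x |-> sum over p in P of (x, p)^d p,
    where P is a finite set of vectors stable under the group: for G_34 the 756
    roots, for G_33 the 80 images of the vector fixed by G(3,3,4).  Such a field
    commutes with the group.  At a point fixed by a reflection its value is
    therefore fixed too, so the field is tangent to all reflecting hyperplanes,
    and the argument that swaps p and its mirror image gives divisibility by
    the linear form as well ([orbit_derivation_tangent]).  The determinant of
    these fields vanishes on every reflecting hyperplane, and its degree is 45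
    or 126; it is not zero at one explicit point.  Hence there are at most 45 or
    126 reflecting hyperplanes, which shows without any enumeration of the group
    that the arrangement is finite and that it consists of the known hyperplanes
    ([reflecting_bound], [arrangement_hyp]).

    The equality between sums of exponents and numbers of hyperplanes is proved
    on a generic line, where the determinant of a basis of D(A) becomes a
    polynomial in one variable with a simple root at each hyperplane
    ([sum_degrees_le], [sum_degrees_ge]).  A hyperplane and its mirror image in H
    meet H in the same subspace, whence |A^H| <= (|A| - 1 + N) / 2, where N is the
    number of lines of roots orthogonal to the root of H
    ([card_restriction_le]).

    The remaining facts about the two root systems are finite computations over
    the Eisenstein integers. *)

Set Implicit Arguments.
Unset Strict Implicit.
Unset Printing Implicit Defensive.

Import Order.TTheory GRing.Theory Num.Theory.

Local Open Scope ring_scope.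

(** * Polynomials and derivations as functions on a vector space *)

Section Evaluation.
Variables (K : fieldType) (V : vectType K).
Local Notation n := (\dim {:V}).
Local Notation e := (vbasis {:V}).
Implicit Types (v w : V) (p q : {mpoly K[\dim {:V}]}) (a : 'Hom(V, K^o)).

Definition ev v p : K := p.@[fun i => coord e i v].

HB.instance Definition _ v := GRing.RMorphism.copy (ev v)
  (meval (fun i => coord e i v)).

Lemma evZ v c p : ev v (c *: p) = c * ev v p.
Proof. exact: mevalZ. Qed.

Lemma ev_lin_form a v : ev v (lin_form a) = a v.
Proof.
rewrite /lin_form rmorph_sum [in RHS](coord_vbasis (memvf v)) linear_sum.
apply: eq_bigr => i _; rewrite linearZ /=.
by rewrite evZ /ev mevalXU mulrC.
Qed.

(** The restriction of p to the affine line t |-> v + t w. *)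
Definition line v w p : {poly K} :=
  mmap polyC (fun i => (coord e i v)%:P + (coord e i w)%:P * 'X) p.

HB.instance Definition _ v w := GRing.RMorphism.copy (line v w)
  (mmap polyC (fun i => (coord e i v)%:P + (coord e i w)%:P * 'X)).

Lemma horner_line v w p t : (line v w p).[t] = ev (v + t *: w) p.
Proof.
rewrite /line /ev /mmap mevalE horner_sum; apply: eq_bigr => m _.
rewrite hornerM hornerC /mmap1 horner_prod; congr (_ * _).
apply: eq_bigr => i _.
by rewrite horner_exp hornerD hornerM !hornerC hornerX linearD linearZ /= [t * _]mulrC.
Qed.

(** The numbers d i are only bounds for the degrees, so the coefficients taken
    here may vanish; lead_coef would not do. *)
Lemma coef_top_prod (I : Type) (r : seq I) (P : pred I)
    (F : I -> {poly K}) (d : I -> nat) :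
  (forall i, (size (F i) <= (d i).+1)%N) ->
  (size (\prod_(i <- r | P i) F i)%R <= (\sum_(i <- r | P i) d i).+1)%N /\
  (\prod_(i <- r | P i) F i)%R`_(\sum_(i <- r | P i) d i)%N
     = \prod_(i <- r | P i) (F i)`_(d i).
Proof.
move=> szF; elim: r => [|i r [IHs IHc]].
  by rewrite !big_nil size_poly1 coef1.
rewrite !big_cons; case: ifP => // _.
have sz_mul (p q : {poly K}) (a b : nat) : (size p <= a.+1)%N -> (size q <= b.+1)%N ->
   (size (p * q)%R <= (a + b).+1)%N /\ (p * q)`_(a + b)%N = p`_a * q`_b.
  move=> pa qb; split.
    apply: leq_trans (size_polyMleq _ _) _.
    by rewrite -subn1 leq_subLR (leq_trans (leq_add pa qb)) // addSn addnS add1n.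
  have lta : (a < (a + b).+1)%N by rewrite ltnS leq_addr.
  rewrite coefM (bigD1 (Ordinal lta)) //= addKn big1 ?addr0 // => j.
  rewrite -val_eqE /= neq_ltn => /orP [ltja|ltaj].
    rewrite [q`__]nth_default ?mulr0 // (leq_trans qb) // ltn_subRL.
    by rewrite ltn_add2r.
  by rewrite nth_default ?mul0r // (leq_trans pa).
have [H1 H2] := sz_mul _ _ _ _ (szF i) IHs.
by rewrite H2 IHc.
Qed.

(** The coefficient of t^d only sees the direction w of the line: each of the d
    linear factors of a monomial contributes the coefficient of t. *)
Lemma line_homog v w p d : p \is d.-homog ->
  (size (line v w p) <= d.+1)%N /\ (line v w p)`_d = ev w p.
Proof.
move=> /dhomogP hp; rewrite /line /ev /mmap mevalE.
have mono m : m \in msupp p ->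
  let q := mmap1 (fun i => (coord e i v)%:P + (coord e i w)%:P * 'X) m in
  (size q <= d.+1)%N /\ q`_d = \prod_i (coord e i w) ^+ m i.
  move=> /hp mE /=; rewrite /mmap1.
  have dE : d = (\sum_i m i)%N by rewrite -mdegE -mE.
  pose g i : {poly K} := (coord e i v)%:P + (coord e i w)%:P * 'X.
  have sz1 i : (size (g i) <= 2)%N.
    rewrite (leq_trans (size_polyD _ _)) // geq_max.
    rewrite (leq_trans (size_polyC_leq1 _)) //= mul_polyC.
    by rewrite (leq_trans (size_scale_leq _ _)) // size_polyX.
  have pw i k : (size (g i ^+ k)%R <= k.+1)%N /\ (g i ^+ k)`_k = (coord e i w) ^+ k.
    have := @coef_top_prod _ (index_enum 'I_k) xpredT (fun=> g i) (fun=> 1%N)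
      (fun=> sz1 i).
    rewrite !prodr_const sum_nat_const cardT size_enum_ord muln1.
    by rewrite /g coefD coefC coefCM coefX mulr1 add0r.
  have [] := @coef_top_prod _ (index_enum 'I_n) xpredT
     (fun i => g i ^+ m i) (fun i => m i) (fun i => (pw i (m i)).1).
  rewrite -dE => -> ->; split=> //; apply: eq_bigr => i _.
  by rewrite (pw i (m i)).2.
split.
  rewrite (leq_trans (size_sum _ _ _)) //; apply/bigmax_leqP_seq => m mp _.
  by rewrite mul_polyC (leq_trans (size_scale_leq _ _)) // (mono m mp).1.
rewrite coef_sum [LHS]big_seq [RHS]big_seq; apply: eq_bigr => m mp.
by rewrite coefCM (mono m mp).2.
Qed.

Lemma line0_homog w p d : p \is d.-homog -> line 0 w p = ev w p *: 'X^d.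
Proof.
move=> /dhomogP hp; rewrite /line /ev /mmap mevalE scaler_suml.
rewrite [LHS]big_seq [RHS]big_seq; apply: eq_bigr => m mp.
rewrite mul_polyC -scalerA; congr (_ *: _).
have <- : mdeg m = d by exact: hp.
rewrite /mmap1 mdegE -prodrXr -mul_polyC rmorph_prod -big_split /=.
apply: eq_bigr => i _; rewrite linear0 add0r exprMn.
by rewrite rmorphXn.
Qed.

Definition der_of (f : 'I_n -> sym_alg V) q : sym_alg V :=
  \sum_i f i * q^`M(i).

Lemma is_derivation_der_of f : is_derivation (der_of f).
Proof.
split=> [c p q|p q]; rewrite /der_of.
  rewrite scaler_sumr -big_split; apply: eq_bigr => i _.
  by rewrite mderivD mderivZ mulrDr scalerAr.
rewrite mulr_suml mulr_sumr -big_split; apply: eq_bigr => i _ /=.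
by rewrite mderivM mulrDr !mulrA [p * _]mulrC.
Qed.

Lemma der_ofX f i : der_of f 'X_i = f i.
Proof.
rewrite /der_of (bigD1 i) //= big1 => [|j ji]; rewrite mderivX mnm1E.
  by rewrite eqxx addr0 scale1r -[X in (X - _)%MM]add0m addmK mpolyX0 mulr1.
by rewrite eq_sym (negbTE ji) scale0r mulr0.
Qed.

Lemma derivation_lin_form theta a : is_derivation theta ->
  theta (lin_form a) = \sum_(i < n) (a e`_i : K) *: theta 'X_i.
Proof.
move=> [lin _]; pose g := GRing.isLinear.Build _ _ _ _ _ lin.
pose th : {linear _ -> _} := HB.pack theta g.
rewrite -[theta]/(th : _ -> _) /lin_form linear_sum.
by apply: eq_bigr => i _; rewrite linearZ.
Qed.

(** A derivation theta as a polynomial vector field on V. *)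
Definition field_of (theta : sym_alg V -> sym_alg V) v : V :=
  \sum_(i < n) ev v (theta 'X_i) *: e`_i.

Lemma lin_field_of theta a v : is_derivation theta ->
  a (field_of theta v) = ev v (theta (lin_form a)).
Proof.
move=> der; rewrite derivation_lin_form // rmorph_sum linear_sum.
by apply: eq_bigr => i _; rewrite linearZ /= evZ mulrC.
Qed.

End Evaluation.

(** * Hyperplanes, linear forms and generic lines *)

Section Generic.
Variable K : numClosedFieldType.

Lemma poly_nonroot (p : {poly K}) : p != 0 -> exists t, p.[t] != 0.
Proof.
move=> p0; have [/hasP [t _ pt]|/hasPn all_root] :=
  boolP (has (fun t => p.[t] != 0) [seq i%:R : K | i <- iota 0 (size p)]).
  by exists t.
have := max_poly_roots p0 (rs := [seq i%:R : K | i <- iota 0 (size p)]).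
rewrite size_map size_iota ltnn => H; suff: false by [].
apply: H.
  by apply/allP => t /all_root; rewrite negbK.
rewrite map_inj_uniq ?iota_uniq // => i j /eqP; rewrite eqr_nat.
by move/eqP.
Qed.

Section Forms.
Variable V : vectType K.
Local Notation n := (\dim {:V}).
Local Notation e := (vbasis {:V}).
Implicit Types (v w u : V) (a : 'Hom(V, K^o)) (H : {vspace V})
  (B : {fset {vspace V}}) (alpha : {vspace V} -> 'Hom(V, K^o)).

(** Induction on the list: if w is good for the tail and u is not a zero of the
    head, then w + t u is good for all t outside a finite set. *)
Lemma exists_generic (L : seq 'Hom(V, K^o)) :
  (forall a, a \in L -> a != 0) -> exists w, forall a, a \in L -> a w != 0.
Proof.
elim: L => [|a L IH] nz; first by exists 0.
have [|w wP] := IH; first by move=> b bL; rewrite nz // inE bL orbT.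
have /lfunPn [u] := nz a (mem_head _ _); rewrite zero_lfunE => au.
pose p := \prod_(b <- a :: L) ((b w : K)%:P + (b u : K) *: 'X).
have pE t : p.[t] = \prod_(b <- a :: L) (b (w + t *: u) : K).
  rewrite horner_prod; apply: eq_bigr => b _.
  by rewrite hornerD hornerZ hornerX hornerC linearD linearZ /= [t *: _]mulrC.
have [|t] := @poly_nonroot p.
  apply/eqP => p0; move/eqP: (p0); rewrite prodf_seq_eq0 => /hasP [b].
  rewrite inE => bL /= /eqP b0.
  have : b w = 0 /\ b u = 0.
    have ev0 t : (b w : K) + (b u : K) * t = 0.
      have := congr1 (fun q : {poly K} => q.[t]) b0.
      by rewrite hornerD hornerC hornerZ hornerX horner0.
    have bw : b w = 0 by have := ev0 0; rewrite mulr0 addr0.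
    by split=> //; have := ev0 1; rewrite bw add0r mulr1.
  case/orP: bL => [/eqP -> [_ /eqP]|/wP /eqP bw [/bw //]].
  by rewrite (negbTE au).
rewrite pE prodf_seq_neq0 => /allP wt.
by exists (w + t *: u) => b /wt.
Qed.

Lemma hyperplane_lker a : a != 0 -> is_hyperplane (lker a).
Proof.
move=> a0; rewrite /is_hyperplane -[RHS](limg_ker_dim a) capfv -addn1; congr (_ + _)%N.
apply/eqP; rewrite eq_sym eqn_leq; apply/andP; split.
  by rewrite (leq_trans (dimvS (subvf _))) // dimvf.
rewrite lt0n dimv_eq0 -lkerE; apply: contra a0 => /subvP k.
by apply/eqP/lfunP => v; rewrite zero_lfunE; apply/eqP; rewrite -memv_ker k ?memvf.
Qed.

Lemma hyperplane_not_full H : is_hyperplane H -> exists v, v \notin H.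
Proof.
move=> dH; apply: boolp.contrapT => allH; move: dH; rewrite /is_hyperplane.
suff -> : H = fullv by move/eqP; rewrite -[X in _ == X]addn0 -addn1 eqn_add2l.
apply/eqP; rewrite eqEsubv subvf; apply/subvP => v _.
by case: (boolP (v \in H)) => // vH; case: allH; exists v.
Qed.

Lemma hyperplane_incl H1 H2 : is_hyperplane H1 -> is_hyperplane H2 ->
  (H1 <= H2)%VS -> H1 = H2.
Proof.
rewrite /is_hyperplane => d1 d2 s; apply/eqP; rewrite eqEdim s /=.
have [->] : (\dim H1).+1 = (\dim H2).+1 by rewrite d1 d2.
exact: leqnn.
Qed.

Lemma hyperplane_notin H1 H2 : is_hyperplane H1 -> is_hyperplane H2 ->
  H1 != H2 -> exists2 v, v \in H1 & v \notin H2.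
Proof.
move=> d1 d2 /eqP ne; apply: boolp.contrapT => al; apply: ne.
apply: hyperplane_incl => //; apply/subvP => v v1.
by case: (boolP (v \in H2)) => // v2; case: al; exists v.
Qed.

(** Some coordinate of the map v |-> v - projv H v, whose kernel is H, is not
    zero. *)
Lemma hyperplane_form H : is_hyperplane H -> exists a, a != 0 /\ lker a = H.
Proof.
move=> dH; have [v vH] := hyperplane_not_full dH.
pose f := fun i => (linfun (coord e i : V -> K^o) \o (\1 - projv H))%VF.
have fE i x : f i x = coord e i (x - projv H x).
  by rewrite comp_lfunE lfunE /= add_lfunE opp_lfunE id_lfunE.
have kf i : (H <= lker (f i))%VS.
  by apply/subvP => x xH; rewrite memv_ker fE projv_id // subrr linear0.
have [i fi] : exists i, f i != 0.
  apply: boolp.contrapT => f0; case/negP: vH.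
  suff -> : v = projv H v by apply: memv_proj.
  apply/eqP; rewrite -subr_eq0; apply/eqP.
  rewrite (coord_vbasis (memvf (v - _))) big1 // => i _.
  have f0i : f i = 0 by apply: boolp.contrapT => /eqP fi; apply: f0; exists i.
  by rewrite -fE f0i zero_lfunE scale0r.
exists (f i); split=> //.
by apply/esym/hyperplane_incl => //; apply: hyperplane_lker.
Qed.

Definition inclusion H : 'Hom(subvs_of H, V) := linfun vsval.

Lemma inclusionE H x : inclusion H x = vsval x.
Proof. by rewrite lfunE. Qed.

Lemma form_on_hyperplane_neq0 H a : is_hyperplane H -> a != 0 -> lker a != H ->
  (a \o inclusion H)%VF != 0.
Proof.
move=> dH a0 ne; rewrite eq_sym in ne.
have [x x1 x2] := hyperplane_notin dH (hyperplane_lker a0) ne.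
apply/lfunPn; exists (vsproj H x).
by rewrite comp_lfunE inclusionE vsprojK // zero_lfunE -memv_ker.
Qed.

Definition forms B alpha := forall H, H \in B -> alpha H != 0 /\ lker (alpha H) = H.

Lemma formsP B : is_arrangement B -> exists alpha, forms B alpha.
Proof.
move=> arr; suff: forall H, exists a, H \in B -> a != 0 /\ lker a = H.
  by move=> /boolp.choice [alpha aP]; exists alpha => H; apply: aP.
move=> H.
have [HB|] := boolP (H \in B); last by exists 0.
by have [a aP] := hyperplane_form (arr _ HB); exists a.
Qed.

Lemma forms_arrangement B alpha : forms B alpha -> is_arrangement B.
Proof. by move=> fB H /fB [a0 <-]; apply: hyperplane_lker. Qed.

(** The value -(alpha H w) / (alpha H u) is the parameter at which the line
    through w in the direction u meets H.  Two of these parameters agree only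
    if u is a zero of alpha_H(w) alpha_H' - alpha_H'(w) alpha_H, which is not the
    zero form. *)
Lemma transversal_line B alpha w : forms B alpha ->
  (forall H, H \in B -> alpha H w != 0) ->
  exists u, (forall H, H \in B -> alpha H u != 0) /\
   {in B &, injective (fun H => - (alpha H w : K) / alpha H u)}.
Proof.
move=> fB wP.
pose L := [seq alpha H | H <- B] ++
  [seq (alpha p.1 w : K) *: alpha p.2 - (alpha p.2 w : K) *: alpha p.1 |
    p <- [seq (H, H') | H <- B, H' <- B] & p.1 != p.2].
have [|u uP] := @exists_generic L.
  move=> a; rewrite mem_cat => /orP [/mapP [H HB ->]|]; first by case: (fB H HB).
  case/mapP => -[H1 H2]; rewrite mem_filter /= => /andP [ne].
  case/allpairsP => -[H1' H2'] /= [B1 B2 [E1 E2]] ->; subst H1' H2'.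
  have [v v1 v2] :=
    hyperplane_notin (forms_arrangement fB B1) (forms_arrangement fB B2) ne.
  have [[_ k1] [_ k2]] := (fB _ B1, fB _ B2).
  rewrite -k1 memv_ker in v1; rewrite -k2 memv_ker in v2.
  apply/lfunPn; exists v.
  rewrite add_lfunE opp_lfunE !scale_lfunE (eqP v1) scaler0 subr0.
  by rewrite zero_lfunE scaler_eq0 negb_or wP.
exists u; split.
  by move=> H HB; apply: uP; rewrite mem_cat map_f.
move=> H1 H2 B1 B2 /= E; apply/eqP; case: eqVneq => // ne.
have /negP[] : (alpha H1 w : K) * alpha H2 u - (alpha H2 w : K) * alpha H1 u != 0.
  have := uP ((alpha H1 w : K) *: alpha H2 - (alpha H2 w : K) *: alpha H1).
  rewrite add_lfunE opp_lfunE !scale_lfunE; apply.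
  rewrite mem_cat; apply/orP; right.
  apply/mapP; exists (H1, H2) => //; rewrite mem_filter ne /=.
  by apply/allpairsP; exists (H1, H2).
have u0 H : H \in B -> alpha H u != 0 by move=> HB; apply: uP; rewrite mem_cat map_f.
move/eqP: E; rewrite !mulNr eqr_opp => /eqP E.
rewrite subr_eq0 -[alpha H1 w](divfK (u0 _ B1)) E -mulrA [alpha H1 u * _]mulrC mulrA.
by rewrite divfK ?u0.
Qed.
End Forms.
End Generic.

(** * The coefficient determinant of a family of derivations *)

Section Jacobian.
Variables (K : fieldType) (V : vectType K).
Local Notation n := (\dim {:V}).
Local Notation e := (vbasis {:V}).
Local Notation S := {mpoly K[n]}.
Implicit Types (v w u : V) (a : 'Hom(V, K^o)) (theta : 'I_n -> sym_alg V -> sym_alg V).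

(** The matrix of Saito's criterion. *)
Definition coef_mx theta : 'M[S]_n := \matrix_(i, j) (theta i 'X_j : S).

Lemma ev_det_coef_mx theta v :
  ev v (\det (coef_mx theta)) = \det (map_mx (ev v) (coef_mx theta)).
Proof. by rewrite det_map_mx. Qed.

(** Independence of the values of the fields at v, free of coordinates. *)
Lemma det_coef_mx_eq0P theta v :
  reflect (exists2 c : 'I_n -> K, exists i, c i != 0
             & \sum_i c i *: field_of (theta i) v = 0)
          (ev v (\det (coef_mx theta)) == 0).
Proof.
rewrite ev_det_coef_mx.
have E (c : 'I_n -> K) : \sum_i c i *: field_of (theta i) v =
   \sum_j (\row_i c i *m map_mx (ev v) (coef_mx theta)) 0 j *: e`_j.
  rewrite /field_of; under eq_bigr do rewrite scaler_sumr.
  rewrite exchange_big /=; apply: eq_bigr => j _.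
  rewrite mxE scaler_suml; apply: eq_bigr => i _.
  by rewrite !mxE scalerA.
apply: (iffP (@det0P _ _ _)) => [[r r0 rM]|[c [i ci] cM]].
  exists (fun i => r 0 i).
    by case/rV0Pn: r0 => i ri; exists i.
  rewrite E big1 // => j _; rewrite [X in X *m _](_ : _ = r) ?rM ?mxE ?scale0r //.
  by apply/rowP => i; rewrite mxE.
exists (\row_i c i); first by apply/rV0Pn; exists i; rewrite mxE.
apply/rowP => j; rewrite [RHS]mxE.
have := congr1 (coord e j) (etrans (esym (E c)) cM).
rewrite linear0 => <-; rewrite coord_sum_free //.
exact: basis_free (vbasisP _).
Qed.

Lemma form_field_of a (th : sym_alg V -> sym_alg V) v :
  (a (field_of th v) : K) = \sum_(j < n) ev v (th 'X_j) * (a e`_j : K).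
Proof. by rewrite linear_sum; apply: eq_bigr => j _; rewrite linearZ. Qed.

(** All columns of the matrix at v are then subject to the linear relation a. *)
Lemma det_coef_mx_tangent theta a v : a != 0 ->
  (forall i, field_of (theta i) v \in lker a) -> ev v (\det (coef_mx theta)) = 0.
Proof.
move=> a0 tan; rewrite ev_det_coef_mx -det_tr; apply/eqP/det0P.
exists (\row_j (a e`_j : K)).
  apply: contra a0 => /eqP r0; apply/eqP/lfunP => x.
  rewrite zero_lfunE (coord_vbasis (memvf x)) linear_sum big1 // => j _.
  have := congr1 (fun r : 'rV_n => r 0 j) r0; rewrite !mxE linearZ /= => ->.
  by rewrite scaler0.
apply/rowP => i; rewrite !mxE.
have := tan i; rewrite memv_ker => /eqP; rewrite form_field_of => {2}<-.
apply: eq_bigr => j _.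
by rewrite !mxE mulrC.
Qed.

Lemma homog_det_coef_mx theta (d : 'I_n -> nat) :
  (forall i j, (theta i 'X_j : S) \is (d i).-homog) ->
  \det (coef_mx theta) \is (\sum_i d i)%N.-homog.
Proof.
move=> hom; apply: rpred_sum => s _; rewrite rpredMsign.
have : forall r : seq 'I_n,
  \prod_(i <- r) (coef_mx theta i (s i)) \is (\sum_(i <- r) d i)%N.-homog.
  elim=> [|i r IH]; first by rewrite !big_nil dhomog1.
  by rewrite !big_cons dhomogM // mxE.
exact.
Qed.

Lemma homogeneous_derivationX p (theta : sym_alg V -> sym_alg V) j :
  homogeneous_derivation p theta -> (theta 'X_j : S) \is p.-homog.
Proof. by case=> f hf E; rewrite E -/(der_of f _) der_ofX. Qed.

End Jacobian.

Section Saito.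
Variables (K : numClosedFieldType) (V : vectType K).
Local Notation n := (\dim {:V}).
Local Notation e := (vbasis {:V}).
Local Notation S := {mpoly K[n]}.
Implicit Types (v w u : V) (a : 'Hom(V, K^o)) (H : {vspace V})
  (B : {fset {vspace V}}) (alpha : {vspace V} -> 'Hom(V, K^o))
  (theta : 'I_n -> sym_alg V -> sym_alg V).

Lemma line_lin_form a v w :
  line v w (lin_form a) = (a v : K)%:P + (a w : K) *: 'X.
Proof.
apply/eqP; rewrite -subr_eq0; apply/eqP.
apply: boolp.contrapT => /eqP /poly_nonroot [t].
rewrite hornerD hornerN horner_line ev_lin_form hornerD hornerC hornerZ hornerX.
by rewrite linearD linearZ /= [t *: _]mulrC subrr eqxx.
Qed.

(** Write Q = alpha_H R.  On H, theta Q = g Q becomes theta(alpha_H) R = 0.  The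
    factor R is not zero on a line of H in a generic direction, and the ring of
    polynomials in one variable is a domain. *)
Lemma log_derivation_tangent B (th : sym_alg V -> sym_alg V) H v : is_arrangement B ->
  log_derivation B th -> H \in B -> v \in H -> field_of th v \in H.
Proof.
move=> arr [der [Q [alpha aP QE] [g gQ]]] HB vH.
suff: field_of th v \in lker (alpha H) by rewrite aP.
rewrite memv_ker lin_field_of //.
pose R : S := \prod_(H' <- (B `\ H)%fset) lin_form (alpha H').
have QR : Q = lin_form (alpha H) * R.
  by rewrite QE (big_fsetD1 _ HB).
have [w wP] : exists w : subvs_of H, forall b,
    b \in [seq (alpha H' \o inclusion H)%VF | H' <- (B `\ H)%fset] -> b w != 0.
  apply: exists_generic => _ /mapP [H' + ->]; rewrite !inE => /andP [ne H'B].
  have kH' := aP _ H'B; apply: form_on_hyperplane_neq0; rewrite ?kH' //.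
    exact: arr.
  have [v' v'H'] := hyperplane_not_full (arr _ H'B).
  by apply: contraNneq v'H' => a0; rewrite -kH' memv_ker a0 zero_lfunE.
have wH : alpha H (vsval w) = 0 by apply/eqP; rewrite -memv_ker aP ?subvsP.
have vH0 : alpha H v = 0 by apply/eqP; rewrite -memv_ker aP.
have : line v (vsval w) (th (lin_form (alpha H))) * line v (vsval w) R = 0.
  apply/eqP/negPn/negP => /poly_nonroot [t]; rewrite hornerM !horner_line => /negP[].
  set x := _ + _; have xH : ev x (lin_form (alpha H)) = 0.
    by rewrite ev_lin_form linearD linearZ /= wH vH0 scaler0 addr0.
  have := congr1 (ev x) gQ; rewrite QR der.2 !rmorphM rmorphD !rmorphM /= xH.
  by rewrite !mul0r addr0 mulr0 => ->.
move/eqP; rewrite mulf_eq0 => /orP [/eqP l0|].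
  have := horner_line v (vsval w) (th (lin_form (alpha H))) 0.
  by rewrite l0 horner0 scale0r addr0 => <-.
rewrite /R rmorph_prod /= prodf_seq_eq0 => /hasP [H' H'B] /=.
rewrite line_lin_form => /eqP l0.
have := congr1 (fun q : {poly K} => q`_1) l0.
rewrite coefD coefC coefZ coefX mulr1 add0r coef0 => w0.
have /negP[] : (alpha H' \o inclusion H)%VF w != 0 by apply/wP/map_f.
by rewrite comp_lfunE inclusionE w0.
Qed.

End Saito.

(** * Determinants of bases of logarithmic derivations *)

Section Exponents.
Variables (K : numClosedFieldType) (V : vectType K).
Local Notation n := (\dim {:V}).
Local Notation e := (vbasis {:V}).
Local Notation S := {mpoly K[n]}.
Implicit Types (v w u : V) (a : 'Hom(V, K^o)) (H : {vspace V})
  (B : {fset {vspace V}}) (alpha : {vspace V} -> 'Hom(V, K^o))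
  (theta : 'I_n -> sym_alg V -> sym_alg V).

(** The Leibniz rule turns divisibility for each linear factor into divisibility
    for the product. *)
Lemma log_derivation_forms B (th : sym_alg V -> sym_alg V) : is_derivation th ->
  (forall H, H \in B -> exists2 a, lker a = H &
     exists g : S, th (lin_form a) = g * lin_form a) ->
  log_derivation B th.
Proof.
move=> der tan; split=> //.
have {}tan : forall H, exists a, H \in B -> lker a = H /\
     exists g : S, th (lin_form a) = g * lin_form a.
  move=> H; have [/tan [a aH gP]|] := boolP (H \in B); first by exists a.
  by exists 0.
have [alpha aP] := boolp.choice tan.
exists (\prod_(H <- B) lin_form (alpha H)).
  by exists alpha => // H /aP [].
have th1 : th 1 = 0.
  have := der.2 1 1; rewrite !mulr1 mul1r => /eqP.
  by rewrite -subr_eq0 opprD addrA subrr add0r oppr_eq0 => /eqP.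
have : forall r : seq {vspace V}, {subset r <= B} -> exists g : S,
  th (\prod_(H <- r) lin_form (alpha H)) = g * \prod_(H <- r) lin_form (alpha H).
  elim=> [|H r IH] rB; first by exists 0; rewrite big_nil th1 mul0r.
  have [|g gE] := IH; first by move=> H' H'r; rewrite rB // inE H'r orbT.
  have [_ [h hE]] := aP _ (rB _ (mem_head _ _)).
  exists (h + g); rewrite big_cons der.2 gE hE mulrDl -!mulrA; congr (_ + _).
  exact: mulrCA.
by apply.
Qed.

(** On a generic line through w the determinant is a nonzero polynomial of degree
    at most the sum of the d i, and it has a root on each hyperplane. *)
Lemma degree_bound B theta (d : 'I_n -> nat) w : is_arrangement B ->
  (forall i j, (theta i 'X_j : S) \is (d i).-homog) ->
  (forall i H v, H \in B -> v \in H -> field_of (theta i) v \in H) ->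
  ev w (\det (coef_mx theta)) != 0 ->
  (#|` B| <= \sum_i d i)%N.
Proof.
move=> arr hom tan Dw; have [alpha aP] := formsP arr.
have wB H : H \in B -> alpha H w != 0.
  move=> HB; apply: contra Dw => aw; apply/eqP.
  have [a0 kH] := aP _ HB.
  apply: (det_coef_mx_tangent a0) => i; rewrite kH; apply: tan => //.
  by rewrite -kH memv_ker.
have [u [uB inj]] := transversal_line aP wB.
pose p := line w u (\det (coef_mx theta)).
have p0 : p != 0.
  apply: contra Dw => /eqP p0.
  have := horner_line w u (\det (coef_mx theta)) 0.
  by rewrite -/p p0 horner0 scale0r addr0 => <-.
have := max_poly_roots p0
  (rs := [seq - (alpha H w : K) / alpha H u | H <- enum_fset B]).
rewrite size_map map_inj_in_uniq ?fset_uniq // => lt_size.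
rewrite -ltnS; apply: leq_trans (line_homog w u (homog_det_coef_mx hom)).1.
apply: lt_size => //.
apply/allP => _ /mapP [H HB ->]; rewrite /root /p horner_line.
have [a0 kH] := aP _ HB.
set x := _ + _; have xH : x \in lker (alpha H).
  by rewrite memv_ker linearD linearZ /= [_ *: _]divfK ?uB // subrr.
by apply/eqP/(det_coef_mx_tangent a0) => i; rewrite kH tan // -kH.
Qed.

(** The fields P_j b_j, with constant vectors b_j, are combinations of the basis;
    compare determinants. *)
Lemma log_basis_det_dvd B theta (P : 'I_n -> S) (b : 'I_n -> V) :
  log_basis B theta ->
  (forall j, log_derivation B (der_of (fun i => coord e i (b j) *: P j))) ->
  exists c : S, c * \det (coef_mx theta) =
    (\prod_j P j) * (\det (\matrix_(j, i) coord e i (b j)))%:MP.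
Proof.
case=> _ gen _ lg.
have [c cE] := boolp.choice (fun j => gen _ (lg j)).
exists (\det (\matrix_(j, i) c j i : 'M[S]_n)).
rewrite -det_mulmx -det_map_mx.
have -> : \prod_j P j = \det (diag_mx (\row_j P j)).
  by rewrite det_diag; apply: eq_bigr => j _; rewrite mxE.
rewrite -det_mulmx; congr (\det _); apply/matrixP => j i.
rewrite !mxE [RHS](bigD1 j) //= [X in _ = _ + X]big1 => [|k kj].
  rewrite !mxE eqxx mulr1n addr0.
  have := cE j 'X_i; rewrite der_ofX -mul_mpolyC mulrC => ->.
  by apply: eq_bigr => k _; rewrite !mxE.
by rewrite !mxE eq_sym (negbTE kj) mulr0n mul0r.
Qed.

Lemma der_of_lin_form (P : S) b a :
  der_of (fun i => coord e i b *: P) (lin_form a) = (a b : K) *: P.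
Proof.
rewrite derivation_lin_form; last exact: is_derivation_der_of.
have -> : (a b : K) = \sum_(i < n) (a e`_i : K) * coord e i b.
  rewrite [in LHS](coord_vbasis (memvf b)) linear_sum.
  by apply: eq_bigr => i _; rewrite linearZ /= mulrC.
rewrite scaler_suml; apply: eq_bigr => i _.
by rewrite der_ofX scalerA.
Qed.

(** The fields Q D_j are logarithmic, hence the determinant divides a power of
    Q. *)
Lemma det_coef_mx_off_arrangement B alpha theta w : forms B alpha ->
  log_basis B theta -> (forall H, H \in B -> alpha H w != 0) ->
  ev w (\det (coef_mx theta)) != 0.
Proof.
move=> aP bas wB; pose Q : S := \prod_(H <- B) lin_form (alpha H).
have [j|c] := log_basis_det_dvd (P := fun=> Q) (b := fun j => e`_j) bas.
  apply: log_derivation_forms; first exact: is_derivation_der_of.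
  move=> H HB; exists (alpha H); first by case: (aP _ HB).
  rewrite der_of_lin_form /Q (big_fsetD1 _ HB) /= [lin_form _ * _]mulrC.
  by eexists; rewrite scalerAl.
rewrite (_ : \matrix_(j, i) _ = 1%:M); last first.
  by apply/matrixP => j i; rewrite !mxE coord_free ?(basis_free (vbasisP _)) // eq_sym.
rewrite det1 mulr1 => /(congr1 (ev w)).
rewrite rmorphM /= => cE; apply/eqP => D0; move/eqP: cE.
rewrite D0 mulr0 eq_sym rmorph_prod prodf_seq_eq0 => /hasP [j _] /=.
rewrite rmorph_prod prodf_seq_eq0 => /hasP [H HB] /=.
by rewrite ev_lin_form (negbTE (wB _ HB)).
Qed.

(** With R = Q / alpha_H, the fields R b for b in H and Q b for one b outside H
    are logarithmic.  Their determinant contains alpha_H only once, so on a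
    transversal line the determinant of a basis has at most a simple root
    at H. *)
Lemma det_coef_mx_simple B alpha theta H : forms B alpha ->
  log_basis B theta -> H \in B ->
  exists c : S, exists2 r : K, r != 0 & c * \det (coef_mx theta) =
   r *: (lin_form (alpha H) * (\prod_(H' <- (B `\ H)%fset) lin_form (alpha H')) ^+ n).
Proof.
move=> aP bas HB; have [a0 kH] := aP _ HB.
pose R : S := \prod_(H' <- (B `\ H)%fset) lin_form (alpha H').
have [j0 aj0] : exists j : 'I_n, alpha H e`_j != 0 :> K.
  apply: boolp.contrapT => none; case/negP: a0; apply/eqP/lfunP => v.
  rewrite zero_lfunE (coord_vbasis (memvf v)) linear_sum big1 // => j _.
  rewrite linearZ /=; have -> : alpha H e`_j = 0; last by rewrite scaler0.
  by apply: boolp.contrapT => /eqP nz; apply: none; exists j.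
pose a (j : 'I_n) : K := alpha H e`_j / alpha H e`_j0.
pose b (j : 'I_n) : V := if j == j0 then e`_j else e`_j - a j *: e`_j0.
pose P (j : 'I_n) : S := if j == j0 then lin_form (alpha H) * R else R.
have [j|c cE] := log_basis_det_dvd (P := P) (b := b) bas.
  apply: log_derivation_forms; first exact: is_derivation_der_of.
  move=> H' H'B; exists (alpha H'); first by case: (aP _ H'B).
  rewrite der_of_lin_form; have [->|ne] := eqVneq H' H.
    rewrite /P /b; case: eqP => [->|_].
      by eexists; rewrite [lin_form _ * _]mulrC scalerAl.
    exists 0; rewrite linearB linearZ /= /a.
    by rewrite [_ *: alpha H _]divfK // subrr scale0r mul0r.
  have [R' RE] : exists R' : S, R = R' * lin_form (alpha H').
    by eexists; rewrite /R (@big_fsetD1 _ _ _ _ H') ?inE ?ne // mulrC.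
  rewrite /P; case: eqP => _; eexists.
    by rewrite RE mulrA scalerAl.
  by rewrite RE scalerAl.
exists c; exists (\det (\matrix_(j, i) coord e i (b j))).
  apply/det0P => -[r r0 /rowP rM]; case/negP: r0; apply/eqP.
  have crd (i j : 'I_n) : coord e i e`_j = (j == i)%:R.
    by rewrite coord_free ?(basis_free (vbasisP _)).
  have rj i : i != j0 -> r 0 i = 0.
    move=> ij; have := rM i; rewrite !mxE (bigD1 i) //= big1 => [|k ki].
      rewrite mxE /b (negbTE ij) addr0 linearB linearZ /= !crd eqxx.
      by rewrite [j0 == i]eq_sym (negbTE ij) mulr0 subr0 mulr1.
    rewrite mxE /b; case: eqP => _; rewrite ?linearB ?linearZ /= !crd (negbTE ki).
      by rewrite mulr0.
    by rewrite eq_sym (negbTE ij) mulr0 subr0 mulr0.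
  apply/rowP => i; rewrite mxE; have [->|/rj //] := eqVneq i j0.
  have := rM j0; rewrite !mxE (bigD1 j0) //= big1 => [|k /rj ->]; last by rewrite mul0r.
  by rewrite mxE /b eqxx crd eqxx mulr1 addr0.
rewrite cE mulrC mul_mpolyC; congr (_ *: _).
rewrite /P (bigD1 j0) //= eqxx (eq_bigr (fun=> R)); last first.
  by move=> j /negbTE ->.
rewrite prodr_const -mulrA -exprS; congr (_ * _ ^+ _).
by rewrite cardC1 card_ord prednK // (leq_ltn_trans _ (ltn_ord j0)).
Qed.

End Exponents.

(** * Sums of exponents *)

Section ExponentSum.
Variables (K : numClosedFieldType) (V : vectType K).
Local Notation n := (\dim {:V}).
Local Notation e := (vbasis {:V}).
Local Notation S := {mpoly K[n]}.
Implicit Types (v w u : V) (a : 'Hom(V, K^o)) (H : {vspace V})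
  (B : {fset {vspace V}}) (alpha : {vspace V} -> 'Hom(V, K^o))
  (theta : 'I_n -> sym_alg V -> sym_alg V).

Lemma off_arrangement B alpha : forms B alpha ->
  exists w, forall H, H \in B -> alpha H w != 0.
Proof.
move=> aP; have [_ /mapP [H /aP [a0 _] ->] //|w wP] :=
  @exists_generic K V [seq alpha H | H <- B].
by exists w => H HB; apply/wP/map_f.
Qed.

(** On a generic line the determinant of the basis has degree exactly the sum of
    the d i; its roots lie on the hyperplanes and are simple. *)
Lemma sum_degrees_le B theta (d : 'I_n -> nat) : is_arrangement B ->
  log_basis B theta -> (forall i, homogeneous_derivation (d i) (theta i)) ->
  (\sum_i d i <= #|` B|)%N.
Proof.
move=> arr bas hom; have [alpha aP] := formsP arr.
have [w wB] := off_arrangement aP.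
have [u [uB inj]] := transversal_line aP wB.
pose D := \det (coef_mx theta); pose p := line w u D.
pose t H : K := - (alpha H w : K) / alpha H u.
have on_line H z : H \in B -> (alpha H (w + z *: u) == 0) = (z == t H).
  move=> HB; rewrite linearD linearZ /= addrC addr_eq0 /t.
  apply/eqP/eqP => [<-|->]; last exact: divfK (uB _ HB) _.
  by rewrite [X in X / _](_ : _ = z * alpha H u) // mulfK ?uB.
have homX i j : (theta i 'X_j : S) \is (d i).-homog by apply: homogeneous_derivationX.
have pd : p`_(\sum_i d i)%N != 0.
  rewrite (line_homog w u (homog_det_coef_mx homX)).2.
  exact: det_coef_mx_off_arrangement aP bas uB.
have p0 : p != 0 by apply: contra pd => /eqP ->; rewrite coef0.
have [r pr] := closed_field_poly_normal p.
have szr : size p = (size r).+1.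
  by rewrite pr size_scale ?lead_coef_eq0 // size_prod_XsubC.
have rE z : z \in r -> exists2 H, H \in B & z = t H.
  move=> zr; apply: boolp.contrapT => none.
  have /negP[] : ev (w + z *: u) D != 0.
    apply: det_coef_mx_off_arrangement aP bas _ => H HB.
    by rewrite on_line //; apply/eqP => zE; apply: none; exists H.
  by rewrite -horner_line -/p pr -/(root _ _) rootZ ?lead_coef_eq0 // root_prod_XsubC.
have simple z : z \in r -> z \notin rem z r.
  move=> zr; apply/negP => zrr; have [H HB zE] := rE z zr.
  have [q pq] : exists q, p = ('X - z%:P) * (('X - z%:P) * q).
    exists (lead_coef p *: \prod_(y <- rem z (rem z r)) ('X - y%:P)).
    rewrite [LHS]pr (perm_big _ (perm_to_rem zr)) big_cons.
    by rewrite (perm_big _ (perm_to_rem zrr)) big_cons -!scalerAr.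
  have [c [s s0 cE]] := det_coef_mx_simple aP bas HB.
  have lE : line w u (lin_form (alpha H)) = (alpha H u : K) *: ('X - z%:P).
    rewrite line_lin_form scalerBr addrC; congr (_ + _).
    rewrite -mul_polyC -polyCM -polyCN; congr _%:P; rewrite zE /t mulrC.
    by rewrite divfK ?uB // opprK.
  move: (congr1 (line w u) cE).
  rewrite -mul_mpolyC !rmorphM rmorphXn /= -/p lE pq.
  rewrite -[line w u s%:MP]/(mmap _ _ _) mmapC /=.
  rewrite [LHS]mulrCA [RHS]mulrCA -scalerAl scalerAr => /mulfI.
  rewrite polyXsubC_eq0 => /(_ isT) /(congr1 (fun f : {poly K} => f.[z])).
  rewrite !(hornerM, hornerZ, hornerXsubC) subrr mul0r mulr0 => /esym/eqP.
  rewrite horner_exp hornerC !mulf_eq0 (negbTE (uB _ HB)) (negbTE s0) /=.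
  rewrite expf_eq0 => /andP [_].
  rewrite horner_line rmorph_prod prodf_seq_eq0 => /hasP [H'].
  rewrite !inE => /andP [ne H'B] /=; rewrite ev_lin_form on_line // zE => /eqP tE.
  by case/eqP: ne; apply: inj => //; rewrite -/(t _) -/(t _) tE.
have ur : uniq r.
  apply: count_mem_uniq => z; have [zr|/count_memPn -> //] := boolP (z \in r).
  rewrite (seq.permP (perm_to_rem zr)) /= eqxx.
  by rewrite (count_memPn (simple z zr)).
apply: (@leq_trans (size r)).
  by rewrite -ltnS -szr ltnNge; apply: contra pd => le; rewrite nth_default.
rewrite -(size_map t (enum_fset B)); apply: uniq_leq_size => // z /rE [H HB ->].
exact: map_f.
Qed.

Lemma sum_degrees_ge B theta (d : 'I_n -> nat) : is_arrangement B ->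
  log_basis B theta -> (forall i, homogeneous_derivation (d i) (theta i)) ->
  (#|` B| <= \sum_i d i)%N.
Proof.
move=> arr bas hom; have [alpha aP] := formsP arr.
have [w wB] := off_arrangement aP.
apply: (degree_bound (w := w) arr).
- by move=> i j; apply: homogeneous_derivationX.
- by case: bas => lg _ _ i H v HB; apply: log_derivation_tangent (lg i) HB.
- exact: det_coef_mx_off_arrangement aP bas wB.
Qed.

(** Expand g_k = sum of c_ki theta_i and take the component of degree dg k of the
    coefficients: on the line through 0 and v, theta_i contributes the factor
    t^(d i), so theta_i0 drops out.  At v, the n values g_k are combinations of
    the n - 1 values theta_i with i != i0. *)
Lemma small_degrees_dependent B theta (d : 'I_n -> nat) i0
    (g : 'I_n -> sym_alg V -> sym_alg V) (dg : 'I_n -> nat) v :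
  log_basis B theta -> (forall i, homogeneous_derivation (d i) (theta i)) ->
  (forall k, log_derivation B (g k)) ->
  (forall k j, (g k 'X_j : S) \is (dg k).-homog) ->
  (forall k, dg k < d i0)%N ->
  ev v (\det (coef_mx g)) = 0.
Proof.
move=> [_ gen _] hom lg homg lt_dg.
have [c cE] := boolp.choice (fun k => gen _ (lg k)).
pose G := \matrix_(k, i) (line 0 v (c k i) * 'X^(d i))`_(dg k).
have GE : map_mx (ev v) (coef_mx g) = G *m map_mx (ev v) (coef_mx theta).
  apply/matrixP => k j; rewrite !mxE.
  have := congr1 (fun f : S => (line 0 v f)`_(dg k)) (cE k 'X_j).
  rewrite (line0_homog _ (homg k j)) coefZ coefXn eqxx mulr1 => ->.
  rewrite rmorph_sum coef_sum; apply: eq_bigr => i _; rewrite !mxE rmorphM /=.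
  by rewrite (line0_homog _ (homogeneous_derivationX j (hom i))) -scalerAr coefZ mulrC.
rewrite ev_det_coef_mx GE det_mulmx.
have -> : \det G = 0; last by rewrite mul0r.
apply/eqP; rewrite -det_tr; apply/det0P; exists (delta_mx 0 i0).
  by apply/rV0Pn; exists i0; rewrite mxE !eqxx oner_eq0.
by rewrite -rowE; apply/rowP => k; rewrite !mxE coefMXn lt_dg.
Qed.

End ExponentSum.

(** * A criterion against inductive freeness *)

Section Criterion.
Variable K : numClosedFieldType.

Lemma inductively_free_last (V : vectType K) (A : {fset {vspace V}}) :
  inductively_free A -> A = fset0 \/
  exists H E' E'', [/\ is_arrangement A, H \in A, has_exponents (A `\ H)%fset E',
    has_exponents (restriction A H) E'' & (E'' `<=` E')%mset].
Proof.
case=> [V'|V' A' H E' E'' arr HA _ _ hE' hE'' sE]; first by left.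
by right; exists H, E', E''.
Qed.

Variable V : vectType K.
Local Notation n := (\dim {:V}).
Local Notation S := {mpoly K[n]}.
Implicit Types (H : {vspace V}) (A : {fset {vspace V}}).

Lemma restriction_arrangement A H : is_arrangement A -> H \in A ->
  is_arrangement (restriction A H).
Proof.
move=> arr HA X /imfsetP [H' /=]; rewrite !inE => /andP [ne H'A] ->.
have [a [a0 kH]] := hyperplane_form (arr _ H'A).
have -> : (linfun (vsval : subvs_of H -> V) @^-1: H')%VS = lker (a \o inclusion H)%VF.
  by apply/vspaceP => x; rewrite memv_ker comp_lfunE -memv_preim -memv_ker kH.
apply/hyperplane_lker/form_on_hyperplane_neq0; rewrite ?kH //.
exact: arr.
Qed.

Lemma dim_subvs H : is_hyperplane H -> (\dim {: subvs_of H}).+1 = n.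
Proof. by move=> dH; rewrite dimvf. Qed.

(** The multiplicities in s dominate those in s', so s' is, up to order, a
    subsequence of s. *)
Lemma mset_large_element (s s' : seq nat) : (seq_mset s' `<=` seq_mset s)%mset ->
  size s = (size s').+1 -> exists2 x, x \in s & sumn s = (x + sumn s')%N.
Proof.
move=> /msubsetP sub sz.
have [|s1 /perm_to_subseq [s2 p2] p1] := (count_subseqP s' s).1.
  by move=> x; have := sub x; rewrite !mset_seqE.
have := perm_size p2; rewrite size_cat sz (perm_size p1) -addn1 => /addnI.
case: s2 p2 => [|x [|//]] // p2 _; exists x.
  by rewrite (perm_mem p2) mem_cat mem_head orbT.
rewrite !sumnE (perm_big _ p2) big_cat /= big_seq1 addnC; congr (_ + _)%N.
by apply: perm_big; rewrite perm_sym.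
Qed.

(** In the last addition step the exponent that exp A^H lacks exceeds D, by the
    hypothesis on |A^H|, whereas the derivations g_k are logarithmic also for
    the smaller arrangement. *)
Lemma not_inductively_free A (g : 'I_n -> sym_alg V -> sym_alg V)
    (dg : 'I_n -> nat) D v :
  A != fset0 ->
  (forall k H, H \in A -> log_derivation (A `\ H)%fset (g k)) ->
  (forall k j, (g k 'X_j : S) \is (dg k).-homog) -> (forall k, dg k <= D)%N ->
  ev v (\det (coef_mx g)) != 0 ->
  (forall H, H \in A -> #|` restriction A H| + D + 1 < #|` A|)%N ->
  ~ inductively_free A.
Proof.
move=> A0 lg hom leD det0 small /inductively_free_last [A0'|].
  by rewrite A0' eqxx in A0.
case=> H [E' [E'' [arr HA ex' ex'' sub]]]; move: ex' ex'' sub.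
move=> [th' [d' [bas' hom' ->]]] [th'' [d'' [bas'' hom'' ->]]] sub.
have [|x] := mset_large_element sub.
  by rewrite !size_image !card_ord dim_subvs //; apply: arr.
case/imageP => i0 _ -> sumE; rewrite !sumnE !big_image /= in sumE.
have arr' : is_arrangement (A `\ H)%fset.
  by move=> H'; rewrite !inE => /andP [_ /arr].
have ge := sum_degrees_ge arr' bas' hom'.
have le := sum_degrees_le (restriction_arrangement arr HA) bas'' hom''.
case/eqP: det0; apply: (small_degrees_dependent v bas' hom' (i0 := i0) _ hom) => k.
  exact: lg.
apply: leq_ltn_trans (leD k) _.
have := small _ HA; rewrite (cardfsD1 H) HA => lt.
rewrite -(ltn_add2r (\sum_i d'' i)) -sumE; apply: leq_trans ge.
rewrite addnC; apply: (@leq_trans (#|` restriction A H| + D).+1).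
  by rewrite ltnS leq_add2r.
by move: lt; rewrite addn1 add1n ltnS.
Qed.

End Criterion.

(** * Unitary reflections and derivations from orbits *)

Section HermitianForm.
Variables (C : numClosedFieldType) (n : nat).
Local Notation V := 'rV[C]_n.
Implicit Types (u v a b c : V).
Local Notation h := (@Defs.hermitian C n).

Lemma hermitianDl u v a : h (u + v) a = h u a + h v a.
Proof. by rewrite -big_split; apply: eq_bigr => i _; rewrite mxE mulrDl. Qed.

Lemma hermitianZl k u a : h (k *: u) a = k * h u a.
Proof.
by rewrite /Defs.hermitian mulr_sumr; apply: eq_bigr => i _; rewrite mxE mulrA.
Qed.

Lemma hermitian_conj u v : (h u v)^* = h v u.
Proof.
rewrite rmorph_sum; apply: eq_bigr => i _.
by rewrite rmorphM /= conjCK mulrC.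
Qed.

Lemma hermitianZr k u a : h a (k *: u) = k^* * h a u.
Proof. by rewrite -hermitian_conj hermitianZl rmorphM /= hermitian_conj. Qed.

Lemma hermitianNl u a : h (- u) a = - h u a.
Proof. by rewrite -scaleN1r hermitianZl mulN1r. Qed.

Lemma hermitianBl u v a : h (u - v) a = h u a - h v a.
Proof. by rewrite hermitianDl hermitianNl. Qed.

Lemma hermitianBr u v a : h a (u - v) = h a u - h a v.
Proof. by rewrite -hermitian_conj hermitianBl rmorphB /= !hermitian_conj. Qed.

Lemma hermitian_eq0 u : (h u u == 0) = (u == 0).
Proof.
apply/eqP/eqP => [/eqP|->]; last first.
  by rewrite /Defs.hermitian big1 // => i _; rewrite mxE mul0r.
rewrite psumr_eq0 => [|i _]; last exact: mul_conjC_ge0.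
move/allP => u0; apply/rowP => i; rewrite mxE; apply/eqP.
by have := u0 i (mem_index_enum i); rewrite mul_conjC_eq0.
Qed.

Lemma refl_is_linear a : linear (fun v : V => v - (2 * h v a / h a a) *: a).
Proof.
move=> k u v; rewrite hermitianDl hermitianZl.
rewrite scalerBr addrACA -opprD scalerA -scalerDl; congr (_ - _ *: _).
by rewrite mulrDr mulrDl !mulrA [k * 2]mulrC.
Qed.

Lemma reflE a v : refl a v = v - (2 * h v a / h a a) *: a.
Proof.
pose L := GRing.isLinear.Build _ _ _ _ _ (refl_is_linear a).
pose f : {linear V -> V} := HB.pack (fun v : V => v - (2 * h v a / h a a) *: a) L.
exact: (lfunE f v).
Qed.

Lemma hermitian_is_linear a : linear (fun v : V => h v a : C^o).
Proof. by move=> k u v; rewrite hermitianDl hermitianZl. Qed.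

Definition hform a : 'Hom(V, C^o) := linfun (fun v : V => h v a : C^o).

Lemma hformE a v : hform a v = h v a.
Proof.
pose L := GRing.isLinear.Build _ _ _ _ _ (hermitian_is_linear a).
pose f : {linear V -> C^o} := HB.pack (fun v : V => h v a : C^o) L.
exact: (lfunE f v).
Qed.

Definition hyp a : {vspace V} := lker (hform a).

Lemma mem_hyp a v : (v \in hyp a) = (h v a == 0).
Proof. by rewrite memv_ker hformE. Qed.

Lemma hform_neq0 a : a != 0 -> hform a != 0.
Proof.
by move=> a0; apply/lfunPn; exists a; rewrite hformE zero_lfunE hermitian_eq0.
Qed.

(** The component of b orthogonal to a lies in hyp a = hyp b, so it is orthogonal
    to itself. *)
Lemma hyp_eq_colinear a b : a != 0 -> hyp a = hyp b -> b = (h b a / h a a) *: a.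
Proof.
move=> a0 E; have aa : h a a != 0 by rewrite hermitian_eq0.
apply/eqP; rewrite -subr_eq0 -hermitian_eq0; set x := _ - _.
have xa : x \in hyp a.
  by rewrite mem_hyp hermitianBl hermitianZl divfK // subrr.
have xb : h x b = 0 by apply/eqP; rewrite -mem_hyp -E.
rewrite {2}/x hermitianBr hermitianZr xb.
by move: xa; rewrite mem_hyp => /eqP ->; rewrite mulr0 subrr.
Qed.

Lemma refl_orthogonal a v : h v a = 0 -> refl a v = v.
Proof. by move=> va; rewrite reflE va mulr0 mul0r scale0r subr0. Qed.

Lemma fixedSpace_refl a : a != 0 -> fixedSpace (refl a) = hyp a.
Proof.
move=> a0; apply/vspaceP => v; rewrite [RHS]mem_hyp.
have -> : (v \in fixedSpace (refl a)) = (refl a v == v).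
  by apply/idP/idP => [/fixedSpaceP ->|/eqP av] //; apply/fixedSpaceP.
rewrite reflE -subr_eq0 addrAC subrr add0r oppr_eq0.
rewrite scaler_eq0 (negbTE a0) orbF mulf_eq0 invr_eq0 hermitian_eq0 (negbTE a0).
by rewrite orbF mulf_eq0 pnatr_eq0.
Qed.

Lemma refl_self a : a != 0 -> refl a a = - a.
Proof.
move=> a0; rewrite reflE mulfK ?hermitian_eq0 //.
by rewrite scaler_nat mulr2n opprD addrA subrr add0r.
Qed.

Lemma reflK a : a != 0 -> involutive (refl a).
Proof.
move=> a0 v; rewrite [refl a v]reflE linearB linearZ /= refl_self // scalerN opprK.
by rewrite reflE subrK.
Qed.

Lemma refl_adjoint a u v : h (refl a u) v = h u (refl a v).
Proof.
rewrite !reflE hermitianBl hermitianBr hermitianZl hermitianZr; congr (_ - _).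
rewrite !rmorphM fmorphV /= !hermitian_conj conjC_nat.
by ring.
Qed.

Lemma refl_isometry a u v : a != 0 -> h (refl a u) (refl a v) = h u v.
Proof. by move=> a0; rewrite refl_adjoint reflK. Qed.

Lemma refl_eq0 a v : a != 0 -> (refl a v == 0) = (v == 0).
Proof. by move=> a0; rewrite -[in RHS](eqtype.inj_eq (inv_inj (reflK a0))) linear0. Qed.

Lemma refl_is_reflection a : a != 0 -> is_reflection (refl a).
Proof.
move=> a0; split; first by exists 2%N => // v; rewrite /= reflK.
  apply/lfunPn; exists a; rewrite refl_self // id_lfunE.
  by rewrite eq_sym -addr_eq0 -mulr2n -scaler_nat scaler_eq0 pnatr_eq0.
by rewrite fixedSpace_refl //; apply/hyperplane_lker/hform_neq0.
Qed.

Lemma refl_scale k a : k != 0 -> refl (k *: a) = refl a.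
Proof.
move=> k0; have [->|a0] := eqVneq a 0; first by rewrite scaler0.
apply/lfunP => v; rewrite !reflE !hermitianZr !hermitianZl.
have kc : k^* != 0 by rewrite conjC_eq0.
have haa : h a a != 0 by rewrite hermitian_eq0.
by rewrite scalerA; congr (_ - _ *: _); field; rewrite k0 kc haa.
Qed.

Lemma refl_refl a b : a != 0 -> refl (refl a b) = (refl a \o refl b \o refl a)%VF.
Proof.
move=> a0; apply/lfunP => v; rewrite !comp_lfunE [RHS]/= [LHS]reflE.
rewrite refl_isometry // [refl b _]reflE [in RHS]linearB [in RHS]linearZ /= reflK //.
by rewrite refl_adjoint.
Qed.

Lemma limg_refl_hyp a b : a != 0 -> (refl a @: hyp b)%VS = hyp (refl a b).
Proof.
move=> a0; apply/vspaceP => v; rewrite mem_hyp -refl_adjoint -mem_hyp.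
apply/memv_imgP/idP => [[u ub ->]|vb]; first by rewrite reflK.
by exists (refl a v); rewrite ?reflK.
Qed.

End HermitianForm.

Section Groups.
Variables (C : numClosedFieldType) (n : nat).
Local Notation V := 'rV[C]_n.
Local Notation h := (@Defs.hermitian C n).
Variables (root : V -> Prop) (P : seq V).
Hypothesis root_neq0 : forall a, root a -> a != 0.
Hypothesis rootP : forall a p, root a -> p \in P -> refl a p \in P.
Hypothesis uniqP : uniq P.
Local Notation X := (fun g : 'End(V) => exists2 a, root a & g = refl a).
Local Notation W := (generated X).

(** Stated as equality up to permutation, the stability of P passes to inverses
    at once. *)
Definition unitary_preserving (g : 'End(V)) : Prop :=
  (forall u v, h (g u) (g v) = h u v) /\ perm_eq (map g P) P.

Lemma isometry_inj (g : 'End(V)) :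
  (forall u v, h (g u) (g v) = h u v) -> lker g == 0%VS.
Proof.
move=> iso; rewrite -subv0; apply/subvP => v; rewrite memv_ker memv0 => /eqP gv.
by rewrite -hermitian_eq0 -iso gv hermitian_eq0.
Qed.

Lemma generated_unitary g : W g -> unitary_preserving g.
Proof.
elim=> {g} [g [a ra ->]||g k _ [ig pg] _ [ik pk]|g _ [ig pg]].
- have a0 := root_neq0 ra; split; first by move=> u v; apply: refl_isometry.
  have ua : uniq (map (refl a) P).
    by rewrite map_inj_uniq //; apply: inv_inj; apply: reflK.
  apply: uniq_perm => //; apply: (uniq_min_size ua _ _).2; last by rewrite size_map.
  by move=> _ /mapP [p pP ->]; apply: rootP.
- split=> [u v|]; first by rewrite !id_lfunE.
  by rewrite (eq_map (fun v => id_lfunE v)) map_id.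
- split=> [u v|]; first by rewrite !comp_lfunE ig ik.
  rewrite (eq_map (fun v => comp_lfunE g k v)) map_comp.
  by apply: perm_trans pg; apply: perm_map.
- have gK v : g ((g^-1)%VF v) = v.
    by rewrite -comp_lfunE lker0_compfV ?id_lfunE // isometry_inj.
  split=> [u v|]; first by rewrite -ig !gK.
  have Kg v : (g^-1)%VF (g v) = v.
    by rewrite -comp_lfunE lker0_compVf ?id_lfunE // isometry_inj.
  have := perm_map (g^-1)%VF pg; rewrite -map_comp (eq_map Kg) map_id.
  by rewrite perm_sym.
Qed.

(** The form is linear in its first argument, so the field is polynomial in x; it
    commutes with every unitary map that permutes P. *)
Definition orbit_field d (x : V) : V := \sum_(p <- P) h x p ^+ d *: p.

Lemma orbit_field_equivariant d g x : W g -> orbit_field d (g x) = g (orbit_field d x).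
Proof.
move=> /generated_unitary [ig pg].
rewrite /orbit_field -(perm_big _ pg) big_map linear_sum.
by apply: eq_bigr => p _; rewrite ig linearZ.
Qed.

Local Notation m := (\dim {:V}).
Local Notation e := (vbasis {:V}).
Local Notation S := {mpoly C[m]}.

Definition orbit_derivation d : sym_alg V -> sym_alg V :=
  der_of (fun i => \sum_(p <- P) coord e i p *: (lin_form (hform p) : S) ^+ d).

Lemma lin_form_homog (a : 'Hom(V, C^o)) : (lin_form a : S) \is 1.-homog.
Proof.
apply: rpred_sum => i _; apply: dhomogZ.
by rewrite dhomogX /= mdeg1.
Qed.

Lemma orbit_derivation_homog d j : (orbit_derivation d 'X_j : S) \is d.-homog.
Proof.
rewrite /orbit_derivation der_ofX; apply: rpred_sum => p _; apply: dhomogZ.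
by rewrite -[X in X.-homog]mul1n; apply/dhomogMn/lin_form_homog.
Qed.

Lemma field_of_orbit_derivation d v :
  field_of (orbit_derivation d) v = orbit_field d v.
Proof.
rewrite /field_of /orbit_field.
under eq_bigr => i _ do rewrite /orbit_derivation der_ofX rmorph_sum scaler_suml.
rewrite exchange_big /=; apply: eq_bigr => p _.
rewrite [X in _ = _ *: X](coord_vbasis (memvf p)) scaler_sumr; apply: eq_bigr => i _.
by rewrite evZ rmorphXn /= ev_lin_form hformE scalerA mulrC.
Qed.

Lemma orbit_derivation_form d (a : 'Hom(V, C^o)) :
  orbit_derivation d (lin_form a) =
  \sum_(p <- P) (a p : C) *: (lin_form (hform p) : S) ^+ d.
Proof.
have -> : orbit_derivation d (lin_form a) =
   \sum_(p <- P)
     der_of (fun i => coord e i p *: (lin_form (hform p) : S) ^+ d) (lin_form a).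
  rewrite /orbit_derivation /der_of exchange_big /=; apply: eq_bigr => i _.
  by rewrite mulr_suml.
by apply: eq_bigr => p _; rewrite der_of_lin_form.
Qed.

(** Let s be the reflection in b.  Averaging the sum over p with the sum over s p,
    where (s p, b) = - (p, b), leaves multiples of l_p^d - l_(s p)^d.  These are
    divisible by l_p - l_(s p), the form of a multiple of b. *)
Lemma orbit_derivation_tangent d b : b != 0 -> W (refl b) ->
  exists g : S, orbit_derivation d (lin_form (hform b)) = g * lin_form (hform b).
Proof.
move=> b0 /generated_unitary [_ pb]; set theta := orbit_derivation d _.
have E1 : theta = \sum_(p <- P) h p b *: (lin_form (hform p) : S) ^+ d.
  by rewrite /theta orbit_derivation_form; apply: eq_bigr => p _; rewrite hformE.
have E2 : theta = \sum_(p <- P) - h p b *: (lin_form (hform (refl b p)) : S) ^+ d.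
  rewrite E1 -(perm_big _ pb) big_map; apply: eq_bigr => p _.
  rewrite refl_adjoint refl_self // -hermitian_conj hermitianNl rmorphN /=.
  by rewrite hermitian_conj.
have lin_sub p : exists c : C,
    (lin_form (hform p) : S) - lin_form (hform (refl b p)) = c *: lin_form (hform b).
  exists (2 * h p b / h b b)^*; rewrite /lin_form -sumrB scaler_sumr.
  apply: eq_bigr => i _; rewrite -scalerBl scalerA; congr (_ *: _).
  by rewrite !hformE reflE hermitianBr hermitianZr opprB addrC subrK.
have [c cE] := boolp.choice lin_sub.
have two : (2 : C) != 0 by rewrite pnatr_eq0.
exists (2^-1 *: \sum_(p <- P) (h p b * c p) *:
   \sum_(i < d) (lin_form (hform p) : S) ^+ (d.-1 - i) *
                lin_form (hform (refl b p)) ^+ i).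
apply: (can_inj (scalerK two)); rewrite -scalerAl scalerA divff // scale1r.
rewrite scaler_nat mulr2n {1}E1 E2 -big_split mulr_suml /=; apply: eq_bigr => p _.
rewrite scaleNr -scalerBr -scalerA -scalerAl; congr (_ *: _).
by rewrite subrXX cE -!scalerAl mulrC.
Qed.

End Groups.

(** * Reflection arrangements *)

(** Each fibre of f has two elements or contains a fixed point of s. *)
Lemma card_imfset_involution (T T' : choiceType) (A : {fset T})
    (s : T -> T) (f : T -> T') :
  {in A, forall x, s x \in A} -> {in A, involutive s} ->
  {in A, forall x, f (s x) = f x} ->
  (2 * #|` [fset f x | x in A]%fset| <= #|` A| + #|` [fset x in A | s x == x]%fset|)%N.
Proof.
move=> sA sK fs.
have -> : (#|` A| + #|` [fset x in A | s x == x]%fset| =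
    \sum_(x <- A) (1 + (s x == x)))%N.
  rewrite big_split /= -card_fset_sum1; congr (_ + _)%N.
  rewrite card_fset_sum1 big_fset /= big_mkcond /=.
  by apply: eq_bigr => x _; case: eqP.
rewrite (partition_big_imfset _ f) /= card_fset_sum1 big_distrr /=.
rewrite [X in (X <= _)%N]big_seq [X in (_ <= X)%N]big_seq.
apply: leq_sum => _ /imfsetP [x /= xA ->]; rewrite muln1.
rewrite big_mkcond /= (big_fsetD1 x xA) /= eqxx; have [_|ne] := eqVneq (s x) x.
  exact: leq_addr.
have sxA : s x \in (A `\ x)%fset by rewrite !inE ne sA.
rewrite (big_fsetD1 _ sxA) /= fs // eqxx addnA.
by apply: leq_trans (leq_addr _ _); rewrite !addnA addn0 leq_addr.
Qed.

Section Arrangement.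
Variables (C : numClosedFieldType) (n : nat).
Local Notation V := 'rV[C]_n.
Local Notation h := (@Defs.hermitian C n).
Variables (root : V -> Prop) (P R : seq V) (ds : seq nat) (x0 : V) (N D : nat).
Hypothesis root_neq0 : forall a, root a -> a != 0.
Hypothesis rootP : forall a p, root a -> p \in P -> refl a p \in P.
Hypothesis uniqP : uniq P.
Local Notation X := (fun g : 'End(V) => exists2 a, root a & g = refl a).
Local Notation W := (generated X).

Hypothesis size_ds : size ds = n.
Hypothesis det0 :
  \det (\matrix_(i < n, j < n) (orbit_field P (nth 0%N ds i) x0) 0 j) != 0.

Local Notation m := (\dim {:V}).
Local Notation S := {mpoly C[m]}.

Definition orbit_derivations (k : 'I_m) : sym_alg V -> sym_alg V :=
  orbit_derivation P (nth 0%N ds k).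

Lemma dim_row : n = m.
Proof. by rewrite dimvf /dim /= mul1n. Qed.

Lemma orbit_derivations_independent : ev x0 (\det (coef_mx orbit_derivations)) != 0.
Proof.
apply: contra det0 => /det_coef_mx_eq0P [c [i ci] sum0]; apply/det0P.
exists (\row_k c (cast_ord dim_row k)).
  apply/rV0Pn; exists (cast_ord (esym dim_row) i); rewrite mxE.
  by rewrite cast_ordKV.
apply/rowP => j; rewrite -sum0 !mxE.
rewrite summxE [RHS](reindex (cast_ord dim_row)) /=; last first.
  exact/onW_bij/(Bijective (cast_ordK _) (cast_ordKV _)).
by apply: eq_bigr => k _; rewrite !mxE field_of_orbit_derivation.
Qed.

Definition reflecting (H : {vspace V}) : Prop :=
  exists g, [/\ W g, is_reflection g & H = fixedSpace g].

Lemma reflecting_tangent d H v : reflecting H -> v \in H -> orbit_field P d v \in H.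
Proof.
move=> [g [Wg _ ->]] /fixedSpaceP gv; apply/fixedSpaceP.
by rewrite -(orbit_field_equivariant root_neq0 rootP uniqP) // gv.
Qed.

Lemma sum_ds : (\sum_(k < m) nth 0%N ds k = sumn ds)%N.
Proof. by rewrite sumnE (big_nth 0%N) size_ds big_mkord; case: (m) / dim_row. Qed.

(** The determinant of the orbit derivations is a nonzero polynomial that vanishes
    on all reflecting hyperplanes. *)
Lemma reflecting_bound (B : {fset {vspace V}}) :
  (forall H, H \in B -> reflecting H) -> (#|` B| <= sumn ds)%N.
Proof.
move=> BR; rewrite -sum_ds.
apply: (degree_bound _ _ _ orbit_derivations_independent).
- by move=> H /BR [g [_ [_ _ dH] ->]].
- by move=> i j; apply: orbit_derivation_homog.
- move=> i H v /BR HR vH; rewrite field_of_orbit_derivation.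
  exact: reflecting_tangent.
Qed.

Local Notation A := (reflection_arrangement W).

(** The bound on finite subsets shows that the set of reflecting hyperplanes is
    finite. *)
Lemma mem_reflection_arrangement H : (H \in A) <-> reflecting H.
Proof.
have fin : cardinality.finite_set reflecting.
  apply: boolp.contrapT => /(cardinality.infinite_set_fset (sumn ds).+1) [B BR].
  by rewrite ltnNge reflecting_bound.
rewrite /reflection_arrangement cardinality.in_fset_set //; split.
  by move/boolp.asboolP.
by move=> HR; apply/boolp.asboolP.
Qed.

Definition reflection_root b := b != 0 /\ W (refl b).

Lemma reflection_root_refl a b :
  reflection_root a -> reflection_root b -> reflection_root (refl a b).
Proof.
move=> [a0 Wa] [b0 Wb]; split; first by rewrite refl_eq0.
by rewrite refl_refl //; do 2![apply: generated_comp => //].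
Qed.

Lemma hyp_reflecting b : reflection_root b -> reflecting (hyp b).
Proof.
move=> [b0 Wb]; exists (refl b); split; rewrite ?fixedSpace_refl //.
exact: refl_is_reflection.
Qed.

Hypothesis rootR : forall b, b \in R -> reflection_root b.
Hypothesis uniqR : uniq R.
Hypothesis distinctR : {in R &, forall b c, b != c -> h b c * h c b != h b b * h c c}.
Hypothesis sizeR : size R = sumn ds.

(** Equality in the inequality of Cauchy and Schwarz characterizes colinear
    vectors. *)
Lemma uniq_hypR : {in R &, injective (@hyp C n)}.
Proof.
move=> b c bR cR E; apply/eqP; case: eqVneq => // /(distinctR bR cR) /eqP[].
have [b0 _] := rootR bR.
have bb : h b b != 0 by rewrite hermitian_eq0.
have := hyp_eq_colinear b0 E; set k := _ / _ => ->.
by rewrite !hermitianZl !hermitianZr; ring.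
Qed.

(** The hyperplanes of R already reach the bound. *)
Lemma arrangement_hyp : A = [fset hyp b | b in R]%fset.
Proof.
apply/esym/eqP; rewrite eqEfcard; apply/andP; split.
  apply/fsubsetP => _ /imfsetP [b /= bR ->].
  by apply/mem_reflection_arrangement/hyp_reflecting/rootR.
rewrite card_in_imfset /=; last exact: uniq_hypR.
rewrite undup_id // sizeR; apply: reflecting_bound => H.
by move/mem_reflection_arrangement.
Qed.

Lemma card_arrangement : #|` A| = size R.
Proof.
by rewrite arrangement_hyp card_in_imfset /= ?undup_id //; exact: uniq_hypR.
Qed.

Hypothesis orthogonalR : forall a, a \in R ->
  (count (fun b => (h b a == 0)%R) R <= N)%N.

(** The reflection in H = hyp a acts on the other hyperplanes, does not change
    their intersection with H, and fixes hyp b only if b is orthogonal to a. *)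
Lemma card_restriction_le H : H \in A ->
  (2 * #|` restriction A H| <= (size R).-1 + N)%N.
Proof.
rewrite arrangement_hyp => /imfsetP [a /= aR ->]; rewrite -arrangement_hyp.
have [a0 Wa] := rootR aR; have ra := rootR aR.
pose s (H' : {vspace V}) := (refl a @: H')%VS.
have aA : hyp a \in A by apply/mem_reflection_arrangement/hyp_reflecting.
have inA H' : H' \in (A `\ hyp a)%fset -> exists2 b, b \in R & H' = hyp b.
  by rewrite inE arrangement_hyp => /andP [_ /imfsetP [b]]; exists b.
have sK H' : H' \in (A `\ hyp a)%fset -> s (s H') = H'.
  by move=> /inA [b bR ->]; rewrite /s !limg_refl_hyp // reflK.
have saa : s (hyp a) = hyp a.
  rewrite /s limg_refl_hyp // refl_self //; apply/vspaceP => v.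
  by rewrite !mem_hyp -scaleN1r hermitianZr mulf_eq0 conjC_eq0 oppr_eq0 oner_eq0.
have sA H' : H' \in (A `\ hyp a)%fset -> s H' \in (A `\ hyp a)%fset.
  move=> H'A; have := H'A; rewrite !in_fsetD1 => /andP [ne _]; apply/andP; split.
    by apply: contra ne => /eqP sE; rewrite -(sK _ H'A) sE saa.
  have [b bR ->] := inA _ H'A; rewrite /s limg_refl_hyp //.
  apply/mem_reflection_arrangement/hyp_reflecting/reflection_root_refl => //.
  exact: rootR.
have cE : #|` (A `\ hyp a)%fset| = (size R).-1.
  by rewrite -card_arrangement (cardfsD1 (hyp a) A) aA.
rewrite -cE; apply: leq_trans (card_imfset_involution sA sK _) _.
  move=> H' H'A; apply/vspaceP => x; rewrite -!memv_preim lfunE /=.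
  have [b bR ->] := inA _ H'A; rewrite /s limg_refl_hyp // !mem_hyp.
  by rewrite -refl_adjoint refl_orthogonal //; apply/eqP; rewrite -mem_hyp subvsP.
rewrite leq_add2l; apply: leq_trans (orthogonalR aR).
rewrite -size_filter -(size_map (@hyp C n)).
apply: uniq_leq_size; first exact: fset_uniq.
move=> H'; rewrite !inE /= => /andP [/andP [ne H'A] /eqP sE].
have [b bR H'b] : exists2 b, b \in R & H' = hyp b by apply: inA; rewrite in_fsetD1 ne.
subst H'; apply: map_f; rewrite mem_filter bR andbT.
have [b0 _] := rootR bR; apply: contraNT ne => hba; apply/eqP.
rewrite /s limg_refl_hyp // in sE.
have := hyp_eq_colinear b0 (esym sE); set k := _ / _.
rewrite reflE; set l := _ / _ => E.
have l0 : l != 0 by rewrite !mulf_neq0 ?invr_eq0 ?hermitian_eq0 ?pnatr_eq0.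
have aE : a = ((1 - k) / l) *: b.
  apply: (scalerI l0); rewrite scalerA mulrCA divff // mulr1 scalerBl scale1r -E.
  by rewrite opprB addrC subrK.
apply/vspaceP => v; rewrite !mem_hyp aE hermitianZr mulf_eq0 conjC_eq0.
suff /negbTE -> : (1 - k) / l != 0 by [].
by apply: contraNneq a0 => k0; rewrite aE k0 scale0r.
Qed.

Hypothesis ds_le : all (fun d => d <= D)%N ds.
Hypothesis gap : (N + 2 * D + 1 < size R)%N.

Theorem reflection_arrangement_not_inductively_free : ~ inductively_free A.
Proof.
apply: (@not_inductively_free _ _ _ orbit_derivations (fun k => nth 0%N ds k) D x0).
- apply/eqP => A0; have := card_arrangement; rewrite A0 cardfs0 => s0.
  by have := gap; rewrite -s0.
- move=> k H HA; apply: log_derivation_forms; first exact: is_derivation_der_of.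
  move=> H'; rewrite inE arrangement_hyp => /andP [_ /imfsetP [b /= bR ->]].
  exists (hform b) => //; have [b0 Wb] := rootR bR.
  exact: (orbit_derivation_tangent root_neq0 rootP uniqP).
- by move=> k j; apply: orbit_derivation_homog.
- move=> k; apply: (allP ds_le); apply: mem_nth.
  by rewrite size_ds [X in (_ < X)%N]dim_row.
- exact: orbit_derivations_independent.
- move=> H /card_restriction_le; rewrite card_arrangement.
  by have := gap; case: (size R) => // r; set y := #|` _|; lia.
Qed.

End Arrangement.

(** * Root systems over the Eisenstein integers *)

(** The pair (a, b) stands for the Eisenstein integer a + b omega.  Binary integers
    and the explicit conditionals below keep evaluation fast: the boolean
    connectives evaluate both of their arguments under call by value. *)
Definition eis : Type := (Z * Z)%type.
HB.instance Definition _ := Equality.copy eis (Z * Z)%type.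

Definition eadd (x y : eis) : eis := (Z.add x.1 y.1, Z.add x.2 y.2).
Definition emul (x y : eis) : eis :=
  (Z.sub (Z.mul x.1 y.1) (Z.mul x.2 y.2),
   Z.sub (Z.add (Z.mul x.1 y.2) (Z.mul x.2 y.1)) (Z.mul x.2 y.2)).
Definition escale (k : Z) (x : eis) : eis := (Z.mul k x.1, Z.mul k x.2).
Definition econj (x : eis) : eis := (Z.sub x.1 x.2, Z.opp x.2).
Fixpoint epow (x : eis) (d : nat) : eis :=
  if d is d'.+1 then emul x (epow x d') else (1%Z, 0%Z).
Definition eis0 : eis := (0%Z, 0%Z).
Definition eis1 : eis := (1%Z, 0%Z).
Definition eroot (k : nat) : eis :=
  match k with 0%N => eis1 | 1%N => (0%Z, 1%Z) | _ => ((-1)%Z, (-1)%Z) end.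

(** The hermitian form in which the i-th coordinate has weight w_i: for G_33 the
    first coordinate is divided by sqrt 2 to keep vectors integral, and it gets
    weight 2. *)
Fixpoint eherm (w : seq Z) (x y : seq eis) : eis :=
  match w, x, y with
  | m :: w', a :: x', b :: y' => eadd (escale m (emul a (econj b))) (eherm w' x' y')
  | _, _, _ => eis0
  end.

(** All roots are scaled to norm 6, so the reflection maps b to b - (h / 3) a
    with h = (b, a); this is three times that vector. *)
Definition ereflect_triple (h : eis) (a b : seq eis) : seq eis :=
  [seq eadd (escale 3 p.1) (escale (-1) (emul h p.2)) | p <- zip b a].

Fixpoint same_vec (x y : seq eis) : bool :=
  match x, y with
  | [::], [::] => true
  | a :: x', b :: y' =>
      if Z.eqb a.1 b.1 then if Z.eqb a.2 b.2 then same_vec x' y' else false else false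
  | _, _ => false
  end.

Fixpoint lazy_has (p : pred (seq eis)) (L : seq (seq eis)) : bool :=
  if L is x :: L' then if p x then true else lazy_has p L' else false.

Definition ereflect (w : seq Z) (a b : seq eis) : option (seq eis) :=
  let c3 := ereflect_triple (eherm w b a) a b in
  let c := [seq (Z.div x.1 3, Z.div x.2 3) | x <- c3] in
  if same_vec [seq escale 3 x | x <- c] c3 then Some c else None.

(** The state consists of the vectors found so far and of those whose images are
    still to be computed. *)
Definition insert (same : rel (seq eis)) (st : seq (seq eis) * seq (seq eis))
    (y : seq eis) :=
  if lazy_has (same y) st.1 then st else (y :: st.1, y :: st.2).

Fixpoint closure (same : rel (seq eis)) (w : seq Z) (gens : seq (seq eis))
    (fuel : nat) (st : seq (seq eis) * seq (seq eis)) : seq (seq eis) :=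
  match fuel, st.2 with
  | f.+1, x :: t =>
      closure same w gens f
        (foldl (insert same) (st.1, t) (pmap (ereflect w ^~ x) gens))
  | _, _ => st.1
  end.

(** The fuel exceeds the number 756 of vectors in the larger orbit. *)
Definition orbit w gens x := closure same_vec w gens 800 ([:: x], [:: x]).

(** For vectors of norm 6 this is equality in the inequality of Cauchy and
    Schwarz. *)
Definition colinear w (a b : seq eis) : bool :=
  let h := eherm w a b in same_vec [:: emul h (econj h)] [:: (36%Z, 0%Z)].

(** One root on each line of the root system, each line found only once. *)
Definition root_lines w gens := closure (colinear w) w gens 200 (gens, gens).

(** The root e_i - omega^k e_j times 1 + 2 omega = sqrt (-3), which has
    norm 6. *)
Definition theta_root n (i j k : nat) : seq eis :=
  mkseq (fun l => if l == i then (1, 2)%Z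
                  else if l == j then emul ((-1), (-2))%Z (eroot k) else eis0) n.

(** The roots e_i - e_(i+1) and e_s - omega e_(s+1) generate the imprimitive group
    on the coordinates from s on. *)
Definition base_roots n s : seq (seq eis) :=
  nseq n eis1 :: theta_root n s s.+1 1 ::
  [seq theta_root n i i.+1 0 | i <- iota s (n - s).-1].

Definition stable w gens (P : seq (seq eis)) :=
  all (fun a => all (fun b =>
    if ereflect w a b is Some c then lazy_has (same_vec c) P else false) P) gens.

(** [orbit_field] in integral coordinates. *)
Definition efield w (P : seq (seq eis)) (z : seq eis) n (d : nat) : seq eis :=
  foldr (fun p acc => let h := epow (eherm w z p) d in
                      [seq eadd (emul h q.1) q.2 | q <- zip p acc]) (nseq n eis0) P.

Fixpoint zsum (f : nat -> Z) (n : nat) : Z :=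
  if n is n'.+1 then Z.add (zsum f n') (f n') else 0%Z.

Definition inverse_mod n q (M N : seq (seq Z)) : bool :=
  all (fun i => all (fun j =>
    Z.eqb (Z.modulo (Z.sub (zsum (fun k => Z.mul (nth 0%Z (nth [::] M i) k)
                                          (nth 0%Z (nth [::] N k) j)) n)
                    (if i == j then 1 else 0)%Z) (Z.of_nat q)) 0)
    (iota 0 n)) (iota 0 n).

Lemma zsumE f n : zsum f n = \sum_(k < n) f k.
Proof. by elim: n => [|n IH]; rewrite ?big_ord0 // big_ord_recr /= IH. Qed.

Lemma Z_of_natE k : Z.of_nat k = k%:R.
Proof. by rewrite -{1}[k]natn rmorph_nat. Qed.

(** The product of the two determinants is 1 modulo q. *)
Lemma det_neq0_inverse_mod n q (M N : seq (seq Z)) : prime q -> inverse_mod n q M N ->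
  \det (\matrix_(i < n, j < n) nth 0%Z (nth [::] M i) j) != 0.
Proof.
move=> q_pr /allP inv.
pose f : {rmorphism Z -> 'F_q} := (intmul 1 : int -> 'F_q) \o int_of_Z.
set A := (X in \det X); pose B : 'M[Z]_n := \matrix_(i, j) nth 0%Z (nth [::] N i) j.
have fq : f (Z.of_nat q) = 0.
  by rewrite Z_of_natE rmorph_nat (pcharf0 (pchar_Fp q_pr)).
suff AB : map_mx f A *m map_mx f B = 1%:M.
  have := congr1 determinant AB; rewrite det_mulmx det1 !det_map_mx => E.
  by apply: contra_eq_neq E => ->; rewrite rmorph0 mul0r eq_sym oner_eq0.
apply/matrixP => i j; rewrite !mxE.
have := inv i; rewrite mem_iota /= ltn_ord => /(_ isT) /allP /(_ j).
rewrite mem_iota /= ltn_ord => /(_ isT) /Z.eqb_eq; rewrite zsumE.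
set v := \sum_(k < n) _; set d := (if _ then _ else _) => vd.
transitivity (f v).
  by rewrite rmorph_sum; apply: eq_bigr => k _; rewrite !mxE -rmorphM.
have -> : v = (d + Z.of_nat q * Z.div (Z.sub v d) (Z.of_nat q))%R.
  have := Z.div_mod (Z.sub v d) (Z.of_nat q); rewrite vd => /(_ _) H.
  have {}H : Z.sub v d = Z.add (Z.mul (Z.of_nat q) (Z.div (Z.sub v d) (Z.of_nat q))) 0.
    by apply: H; have := prime_gt0 q_pr; lia.
  rewrite -[(_ + _)%R]/(Z.add _ (Z.mul _ _)); lia.
rewrite (rmorphD f) (rmorphM f) fq mul0r addr0 /d -val_eqE /=.
by case: ifP => _; rewrite ?rmorph1 ?rmorph0.
Qed.

Section Concrete.
Variable C : numClosedFieldType.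
Local Notation w3 := (omega C).

Lemma omega_sqr : w3 ^+ 2 = - 1 - w3.
Proof.
have i2 : ('i : C) ^+ 2 = -1 by exact: sqrCi.
have s3 : (sqrtC 3 : C) ^+ 2 = 3 by exact: sqrtCK.
rewrite /omega; move: ('i : C) (sqrtC 3 : C) i2 s3 => x y x2 y2.
by rewrite expr_div_n sqrrD exprMn x2 y2; field.
Qed.

Lemma omega_conj : w3^* = - 1 - w3.
Proof.
have s3 : (sqrtC 3 : C)^* = sqrtC 3 by rewrite conj_Creal // ger0_real // sqrtC_ge0.
rewrite /omega fmorph_div rmorphD rmorphN rmorphM /= conjCi s3 conjC1 conjC_nat.
by field.
Qed.

Lemma omega_exp3 : w3 ^+ 3 = 1.
Proof. by rewrite exprS omega_sqr mulrBr mulrN1 -expr2 omega_sqr opprB opprK addKr. Qed.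

Definition zC (z : Z) : C := (int_of_Z z)%:~R.

Lemma zCD x y : zC (Z.add x y) = zC x + zC y.
Proof. by rewrite /zC -[Z.add x y]/(x + y) !rmorphD. Qed.
Lemma zCM x y : zC (Z.mul x y) = zC x * zC y.
Proof. by rewrite /zC -[Z.mul x y]/(x * y) !rmorphM. Qed.
Lemma zCN x : zC (Z.opp x) = - zC x.
Proof. by rewrite /zC -[Z.opp x]/(- x) !rmorphN. Qed.
Lemma zCB x y : zC (Z.sub x y) = zC x - zC y.
Proof. by rewrite -zCN -zCD. Qed.
Lemma zC_inj : injective zC.
Proof. by apply: inj_comp; [apply: intr_inj|apply: can_inj int_of_ZK]. Qed.

Definition toC (x : eis) : C := zC x.1 + zC x.2 * w3.

Lemma toCD x y : toC (eadd x y) = toC x + toC y.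
Proof. by rewrite /toC /= !zCD; ring. Qed.
Lemma toCM x y : toC (emul x y) = toC x * toC y.
Proof.
rewrite /toC /= !(zCB, zCD, zCM).
have -> : forall a b c d : C, (a + b * w3) * (c + d * w3) =
  a * c + (a * d + b * c) * w3 + b * d * w3 ^+ 2 by move=> *; ring.
by rewrite omega_sqr; ring.
Qed.
Lemma toCZ k x : toC (escale k x) = zC k * toC x.
Proof. by rewrite /toC /= !zCM; ring. Qed.
Lemma toC_conj x : toC (econj x) = (toC x)^*.
Proof.
have zc z : (zC z)^* = zC z by rewrite /zC rmorph_int.
by rewrite /toC /= rmorphD rmorphM /= !zc omega_conj zCB zCN; ring.
Qed.
Lemma toCX x d : toC (epow x d) = toC x ^+ d.
Proof.
elim: d => [|d IH]; last by rewrite exprS -IH -toCM.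
by rewrite /toC /= mul0r addr0.
Qed.
Lemma toC0 : toC eis0 = 0.
Proof. by rewrite /toC /= mul0r addr0. Qed.
(** From a + b omega = 0 and its conjugate, b (1 + 2 omega) = 0, and the square of
    1 + 2 omega is - 3. *)
Lemma toC_inj : injective toC.
Proof.
move=> [a b] [c d] /eqP; rewrite -subr_eq0 => /eqP E.
have E1 : zC (Z.sub a c) + zC (Z.sub b d) * w3 = 0.
  by rewrite -E /toC /= !zCB; ring.
have E2 : zC (Z.sub a c) + zC (Z.sub b d) * (- 1 - w3) = 0.
  have := congr1 Num.conj E1; rewrite conjC0 => <-.
  have := toC_conj (Z.sub a c, Z.sub b d).
  by rewrite /toC /= => <-; rewrite zCB zCN; ring.
have sqrt3 : (w3 *+ 2 + 1) ^+ 2 = - 3.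
  transitivity (4 * w3 ^+ 2 + 4 * w3 + 1); first by ring.
  by rewrite omega_sqr; ring.
have bd : zC (Z.sub b d) * (w3 *+ 2 + 1) = 0.
  transitivity (0 - 0 : C); last by rewrite subrr.
  by rewrite -{1}E1 -E2; ring.
have {}bd : zC (Z.sub b d) = zC 0%Z.
  move/eqP: bd; rewrite mulf_eq0 => /orP [/eqP -> //|/eqP w0].
  by move/eqP: sqrt3; rewrite w0 expr0n /= eq_sym oppr_eq0 pnatr_eq0.
have {}ac : zC (Z.sub a c) = zC 0%Z by rewrite -[RHS]E1 bd mul0r addr0.
by move: (zC_inj bd) (zC_inj ac) => bd' ac'; congr (_, _); lia.
Qed.

Section Vectors.
Variables (n s : nat) (sc : 'I_n -> C) (w : seq Z).
Hypothesis size_w : size w = n.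
Hypothesis scM : forall i, sc i * (sc i)^* = zC (nth 0%Z w i).
Hypothesis sc_neq0 : forall i, sc i != 0.
Local Notation V := 'rV[C]_n.
Local Notation h := (@Defs.hermitian C n).

(** The scaling sc i, with |sc i|^2 = w_i, is sqrt 2 in the first coordinate of the
    space of G_33 and 1 elsewhere. *)
Definition vec (z : seq eis) : V := \row_i (sc i * toC (nth eis0 z i)).

Lemma eherm_sum (x y : seq eis) : size x = n -> size y = n ->
  toC (eherm w x y) =
  \sum_(i < n) zC (nth 0%Z w i) * (toC (nth eis0 x i) * (toC (nth eis0 y i))^*).
Proof.
move: size_w; clear; move: n => m.
elim: w m x y => [|k w' IH] [|m] // [|a x] // [|b y] //.
  by rewrite big_ord0 toC0.
move=> /= [sw] [sx] [sy]; rewrite toCD toCZ toCM toC_conj (IH m) //.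
by rewrite big_ord_recl.
Qed.

Lemma hermitian_vec x y : size x = n -> size y = n ->
  h (vec x) (vec y) = toC (eherm w x y).
Proof.
move=> sx sy; rewrite eherm_sum //; apply: eq_bigr => i _.
by rewrite !mxE rmorphM /= mulrACA scM.
Qed.

Lemma vec_inj x y : size x = n -> size y = n -> vec x = vec y -> x = y.
Proof.
move=> sx sy E; apply: (@eq_from_nth _ eis0); rewrite ?sx ?sy // => i lti.
have := congr1 (fun v : V => v 0 (Ordinal lti)) E; rewrite !mxE /=.
by move/(mulfI (sc_neq0 _))/toC_inj.
Qed.

Lemma same_vecP x y : reflect (x = y) (same_vec x y).
Proof.
apply: (iffP idP) => [|<-]; last first.
  by elim: x => //= a x ->; rewrite !Z.eqb_refl.
elim: x y => [|[a b] x IH] [|[c d] y] //=.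
by case: Z.eqb_spec => // -> ; case: Z.eqb_spec => // -> /IH ->.
Qed.

Lemma lazy_hasE p L : lazy_has p L = has p L.
Proof. by elim: L => //= x L ->; case: (p x). Qed.

Definition has_norm6 (a : seq eis)   :=
  (size a == n) && same_vec [:: eherm w a a] [:: (6, 0)%Z].

Lemma zC_nat k : zC (Z.of_nat k) = k%:R.
Proof. by rewrite /zC Z_of_natE !rmorph_nat. Qed.

Lemma has_norm6P a : has_norm6 a -> size a = n /\ h (vec a) (vec a) = 6.
Proof.
case/andP => /eqP sa /same_vecP [E]; split=> //.
rewrite hermitian_vec // E /toC /= -[6%Z]/(Z.of_nat 6) -[0%Z]/(Z.of_nat 0) !zC_nat.
by rewrite mul0r addr0.
Qed.

Lemma ereflectP a b c : has_norm6 a -> size b = n -> ereflect w a b = Some c ->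
  size c = n /\ refl (vec a) (vec b) = vec c.
Proof.
move=> /has_norm6P [sa aa] sb; rewrite /ereflect; case: same_vecP => // E [<-].
set c' := [seq (Z.div x.1 3, Z.div x.2 3) | x <- _] in E *; have sc' : size c' = n.
  by rewrite !size_map size_zip sa sb minnn.
split=> //; rewrite reflE aa hermitian_vec //; apply/rowP => i; rewrite !mxE.
have := congr1 (fun l => toC (nth eis0 l i)) E.
rewrite (nth_map eis0) ?sc' // /ereflect_triple.
rewrite (nth_map (eis0, eis0)) ?size_zip ?sa ?sb ?minnn //.
rewrite nth_zip ?sa ?sb //= !(toCD, toCZ, toCM).
rewrite -[3%Z]/(Z.of_nat 3) -[(-1)%Z]/(Z.opp (Z.of_nat 1)) zCN !zC_nat => E3.
have three : (3 : C) != 0 by rewrite pnatr_eq0.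
apply: (mulfI three); rewrite [RHS]mulrCA E3.
set x := toC _; set y := toC (nth _ a _); set z := toC _.
by field.
Qed.

Lemma insert_mem same st y x :
  x \in (insert same st y).1 ++ (insert same st y).2 -> x = y \/ x \in st.1 ++ st.2.
Proof.
rewrite /insert; case: ifP => _; first by right.
by rewrite /= !(mem_cat, inE); case: eqP => [->|_] /=; [left|right].
Qed.

Lemma closure_ind same gens (Q : seq eis -> Prop) fuel st :
  (forall a b c, a \in gens -> Q b -> ereflect w a b = Some c -> Q c) ->
  (forall x, x \in st.1 ++ st.2 -> Q x) ->
  forall x, x \in closure same w gens fuel st -> Q x.
Proof.
move=> Qrefl; elim: fuel st => [|f IH] [seen todo] /= Qst.
  by move=> x xs; apply: Qst; rewrite mem_cat xs.
case: todo Qst => [|y t] Qst; first by move=> x xs; apply: Qst; rewrite mem_cat xs.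
apply: IH.
have Qy : Q y by apply: Qst; rewrite mem_cat mem_head orbT.
have Qnew x : x \in pmap (ereflect w ^~ y) gens -> Q x.
  rewrite mem_pmap => /mapP [a ag /esym]; exact: Qrefl.
have {Qst} : forall x, x \in (seen, t).1 ++ (seen, t).2 -> Q x.
  move=> x; rewrite /= mem_cat => /orP [xs|xt]; apply: Qst.
    by rewrite mem_cat xs.
  by rewrite mem_cat inE xt !orbT.
elim: (pmap _ _) (seen, t) Qnew => [//|z r IHr] st' Qnew Qst /=.
apply: IHr => [x xr|x /insert_mem [->|]]; last exact: Qst.
  by apply: Qnew; rewrite inE xr orbT.
by apply: Qnew; rewrite mem_head.
Qed.

(** A vector is inserted only after the comparison with those found before. *)
Lemma closure_pairwise (same : rel (seq eis)) gens fuel st :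
  pairwise (fun x y => ~~ same x y) st.1 ->
  pairwise (fun x y => ~~ same x y) (closure same w gens fuel st).
Proof.
elim: fuel st => [|f IH] [seen todo] //=.
case: todo => [|y t] // pw; apply: IH => /=.
elim: (pmap _ _) seen t pw => [//|z r IHr] seen t pw /=.
rewrite /insert lazy_hasE; case: ifP => /= hz; apply: IHr => //=.
by rewrite pw andbT; apply/allP => x xs; move/hasPn: hz => /(_ x xs).
Qed.

Lemma pairwise_mem (T : eqType) (r : rel T) (L : seq T) x y :
  pairwise r L -> x \in L -> y \in L -> x != y -> r x y || r y x.
Proof.
elim: L => //= z L IH /andP [/allP az pw]; rewrite !inE.
case/orP => [/eqP ->|xL] /orP [/eqP ->|yL]; rewrite ?eqxx // => ne.
- by rewrite az.
- by rewrite az ?orbT.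
- exact: IH.
Qed.

Lemma vec_neq0 a : h (vec a) (vec a) = 6 -> vec a != 0.
Proof. by rewrite -hermitian_eq0 => ->; rewrite pnatr_eq0. Qed.

Lemma colinearE a b : size a = n -> size b = n ->
  colinear w a b = (h (vec a) (vec b) * h (vec b) (vec a) == 6 * 6).
Proof.
move=> sa sb; have -> : h (vec b) (vec a) = (h (vec a) (vec b))^*.
  by rewrite hermitian_conj.
rewrite hermitian_vec // -toC_conj -toCM -natrM.
have -> : (6 * 6)%:R = toC (36, 0)%Z.
  by rewrite /toC /= -[36%Z]/(Z.of_nat 36) -[0%Z]/(Z.of_nat 0) !zC_nat mul0r addr0.
rewrite (eqtype.inj_eq toC_inj) /colinear.
by apply/same_vecP/eqP => [/(congr1 (head eis0))|->].
Qed.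

Lemma colinear_scale a b : size a = n -> size b = n ->
  h (vec a) (vec a) = 6 -> h (vec b) (vec b) = 6 -> colinear w a b ->
  exists2 k, k != 0 & vec b = k *: vec a.
Proof.
move=> sa sb aa bb; rewrite colinearE // => /eqP ab.
have six : (6 : C) != 0 by rewrite pnatr_eq0.
pose k := h (vec b) (vec a) / 6.
have bE : vec b = k *: vec a.
  apply/eqP; rewrite -subr_eq0 -hermitian_eq0.
  rewrite hermitianBl !hermitianBr !hermitianZl !hermitianZr aa bb.
  rewrite /k fmorph_div /= hermitian_conj conjC_nat.
  apply/eqP; move: ab; set x := h _ _; set y := h _ _ => xy.
  transitivity (6 - x * y / 6); first by field.
  by rewrite xy mulfK // subrr.
exists k => //; apply: contraTneq (vec_neq0 bb) => k0.
by rewrite bE k0 scale0r eqxx.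
Qed.

Definition gens := base_roots n s.

(** The search produces new roots only by reflecting in base roots.  T will be the
    property that the reflection lies in the group, or that it preserves P. *)
Lemma lines_ind (T : V -> Prop) : all has_norm6 gens ->
  (forall a, a \in gens -> T (vec a)) ->
  (forall a b, T a -> T b -> T (refl a b)) ->
  forall b, b \in root_lines w gens ->
  [/\ size b = n, h (vec b) (vec b) = 6 & T (vec b)].
Proof.
move=> /allP n6 Tg Tr; apply: closure_ind => [a b c ag [sb bb Tb] abc|x].
  have [sc' cE] := ereflectP (n6 _ ag) sb abc.
  have a0 := vec_neq0 (has_norm6P (n6 _ ag)).2.
  split=> //; first by rewrite -cE refl_isometry.
  by rewrite -cE; apply/Tr => //; apply: Tg.
rewrite mem_cat orbb => xg; have [sx xx] := has_norm6P (n6 _ xg).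
by split=> //; apply: Tg.
Qed.

(* The predicate root is the set of generating roots of G_33 (s = 1) or of G_34
   (s = 0). *)
Variable root : V -> Prop.
Hypothesis lt_s : (s.+1 < n)%N.
Hypothesis sc1 : forall i : 'I_n, (s <= i)%N -> sc i = 1.
Hypothesis root_cases : forall a, root a <->
  (exists (i j : 'I_n) k, [/\ (s <= i)%N, (s <= j)%N, i != j &
     a = delta_mx 0 i - w3 ^+ k *: delta_mx 0 j]) \/ a = \row_i sc i.

Lemma toC_eroot k : (k < 3)%N -> toC (eroot k) = w3 ^+ k.
Proof.
have z1 : zC 1%Z = 1 by rewrite -[1%Z]/(Z.of_nat 1) zC_nat.
have z0 : zC 0%Z = 0 by rewrite -[0%Z]/(Z.of_nat 0) zC_nat.
have zN1 : zC (-1)%Z = -1 by rewrite -[(-1)%Z]/(Z.opp 1) zCN z1.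
case: k => [|[|[|]]] // _; rewrite /toC /= ?z1 ?z0 ?zN1 ?omega_sqr.
- by rewrite mul0r addr0.
- by rewrite mul1r add0r.
- by rewrite mulN1r.
Qed.

Lemma vec_theta_root (i j : 'I_n) k : (s <= i)%N -> (s <= j)%N -> i != j -> (k < 3)%N ->
  vec (theta_root n i j k) = toC (1, 2)%Z *: (delta_mx 0 i - w3 ^+ k *: delta_mx 0 j).
Proof.
move=> si sj ij k3; apply/rowP => l; rewrite !mxE nth_mkseq //= !val_eqE.
have [->|li] := eqVneq l i.
  by rewrite (negbTE ij) /= mulr0 subr0 mulr1 sc1 // mul1r.
have [->|lj] := eqVneq l j; last by rewrite toC0 !mulr0 subrr mulr0.
rewrite /= sc1 // mul1r sub0r mulr1 toCM toC_eroot // mulrN -mulNr; congr (_ * _).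
by rewrite /toC /= -[(-1)%Z]/(Z.opp 1) -[(-2)%Z]/(Z.opp 2) !zCN mulNr opprD.
Qed.

Lemma vec_ones : vec (nseq n eis1) = \row_i sc i.
Proof.
apply/rowP => i; rewrite !mxE nth_nseq ltn_ord.
by rewrite -[eis1]/(eroot 0) toC_eroot // expr0 mulr1.
Qed.

Lemma toC12_neq0 : toC (1, 2)%Z != 0.
Proof. by rewrite -toC0; apply/eqP => /toC_inj. Qed.

Lemma gens_root g : g \in gens -> exists2 a, root a & refl (vec g) = refl a.
Proof.
have tr i j k : (s <= i < n)%N -> (s <= j < n)%N -> i != j -> (k < 3)%N ->
    exists2 a, root a & refl (vec (theta_root n i j k)) = refl a.
  case/andP => si ni /andP [sj nj] ij k3.
  exists (delta_mx 0 (Ordinal ni) - w3 ^+ k *: delta_mx 0 (Ordinal nj)).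
    by apply/root_cases; left; exists (Ordinal ni), (Ordinal nj), k.
  by rewrite (@vec_theta_root (Ordinal ni) (Ordinal nj) k) // refl_scale // toC12_neq0.
rewrite !inE => /or3P [/eqP ->|/eqP ->|gi].
- by exists (\row_i sc i); [apply/root_cases; right|rewrite vec_ones].
- by apply: tr; rewrite ?leqnn ?leqnSn ?(ltnW lt_s) // neq_ltn ltnSn.
case/seq.mapP: gi => i; rewrite mem_iota => /andP [si lti] ->.
by apply: tr; rewrite ?neq_ltn ?ltnSn //; lia.
Qed.

(** Every generating root lies on one of the lines in L. *)
Definition root_lines_check (L : seq (seq eis)) :=
  has (colinear w (nseq n eis1)) L &&
  all (fun i => all (fun j => all (fun k => (i == j) ||
     (has_norm6 (theta_root n i j k) && lazy_has (colinear w (theta_root n i j k)) L))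
     (iota 0 3)) (iota s (n - s))) (iota s (n - s)).

Hypothesis gens_has_norm6 : all has_norm6 gens.
(* The computed lists L and orb are variables with an equation, so that
   conversion never unfolds the search that produces them. *)
Variable L : seq (seq eis).
Hypothesis LE : L = root_lines w gens.
Hypothesis lines_check : root_lines_check L.

Lemma L_ind (T : V -> Prop) :
  (forall a, a \in gens -> T (vec a)) ->
  (forall a b, T a -> T b -> T (refl a b)) ->
  forall b, b \in L -> [/\ size b = n, h (vec b) (vec b) = 6 & T (vec b)].
Proof. by rewrite LE; apply: lines_ind. Qed.

Lemma root_line a : root a ->
  a != 0 /\ exists2 r, r \in L & refl a = refl (vec r).
Proof.
have sizes := @L_ind (fun=> True) (fun _ _ => I) (fun _ _ _ _ => I).
have key b k : has_norm6 b -> has (colinear w b) L -> vec b = k *: a ->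
    a != 0 /\ exists2 r, r \in L & refl a = refl (vec r).
  move=> /has_norm6P [sb bb] /hasP [r rL br] bE.
  have [sr rr _] := sizes _ rL.
  have [l l0 rE] := colinear_scale sb sr bb rr br.
  have := vec_neq0 bb; rewrite bE scaler_eq0 negb_or => /andP [k0 a0].
  by split=> //; exists r => //; rewrite rE refl_scale // bE refl_scale.
have [c1 /allP c2] := andP lines_check.
case/root_cases => [[i [j [k [si sj ij aE]]]]|aE]; last first.
  apply: (key (nseq n eis1) 1) => //; last by rewrite vec_ones aE scale1r.
  exact: (allP gens_has_norm6 _ (mem_head _ _)).
have k3 : (k %% 3 < 3)%N by rewrite ltn_mod.
have := c2 i; rewrite mem_iota si subnKC ?ltn_ord; last by lia.
move=> /(_ isT) /allP /(_ j); rewrite mem_iota sj subnKC ?ltn_ord; last by lia.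
move=> /(_ isT) /allP /(_ (k %% 3)%N); rewrite mem_iota k3 => /(_ isT).
rewrite val_eqE (negbTE ij) lazy_hasE => /andP [nt ht].
apply: (key _ (toC (1, 2)%Z) nt ht); rewrite vec_theta_root // aE.
by rewrite {2}(divn_eq k 3) exprD mulnC exprM omega_exp3 expr1n mul1r.
Qed.

Variables (p0 z : seq eis) (ds : seq nat) (q N D : nat) (Ninv : seq (seq Z)).
Variable orb : seq (seq eis).
Hypothesis orbE : orb = orbit w gens p0.
Hypothesis size_p0 : size p0 = n.
Hypothesis orb_stable : stable w gens orb.

Lemma size_orbit p : p \in orb -> size p = n.
Proof.
move: p; rewrite orbE.
apply: (@closure_ind _ _ (fun p => size p = n)) => [a b c ag sb abc|x].
  exact: (ereflectP (allP gens_has_norm6 _ ag) sb abc).1.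
by rewrite mem_cat !inE orbb => /eqP ->.
Qed.

Lemma uniq_orbit : uniq (map vec orb).
Proof.
rewrite map_inj_in_uniq => [|x y /size_orbit sx /size_orbit sy]; last exact: vec_inj.
rewrite uniq_pairwise orbE; apply: sub_pairwise (closure_pairwise _ _ _) => // x y /=.
by apply: contraNN => /eqP ->; apply/same_vecP.
Qed.

(** The reflection in s_a b is s_a s_b s_a, so it is enough to check the few base
    roots. *)
Lemma root_orbit a p : root a -> p \in map vec orb -> refl a p \in map vec orb.
Proof.
move=> /root_line [a0 [r rL ->]].
pose T (b : V) := b != 0 /\ forall p, p \in map vec orb -> refl b p \in map vec orb.
have [||_ _ [_]] := @L_ind T _ _ r rL; last by apply.
- move=> g gg; have [sg ng] := has_norm6P (allP gens_has_norm6 _ gg).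
  split; first exact: vec_neq0.
  move=> _ /mapP [b bo ->]; have /allP /(_ _ bo) := allP orb_stable _ gg.
  case E: (ereflect w g b) => [c|//]; rewrite lazy_hasE => /hasP [c' co /same_vecP cc'].
  have [_ ->] := ereflectP (allP gens_has_norm6 _ gg) (size_orbit bo) E.
  by rewrite cc' map_f.
- move=> b c [b0 bT] [c0 cT]; split; first by rewrite refl_eq0.
  by move=> x xo; rewrite refl_refl // !comp_lfunE; apply/bT/cT/bT.
Qed.

Definition det_check :=
  let F := [seq efield w orb z n d | d <- ds] in
  all (all (fun x => Z.eqb x.2 0)) F &&
  inverse_mod n q [seq [seq x.1 | x <- f] | f <- F] Ninv.

Hypothesis size_z : size z = n.
Hypothesis size_ds : size ds = n.

Lemma efieldP d j : size (efield w orb z n d) = n /\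
  sc j * toC (nth eis0 (efield w orb z n d) j) = orbit_field (map vec orb) d (vec z) 0 j.
Proof.
rewrite /efield /orbit_field big_map summxE.
have : forall p, p \in orb -> size p = n by exact: size_orbit.
elim: orb => [|p r IH] szP /=.
  by rewrite size_nseq big_nil nth_nseq if_same toC0 mulr0.
have [|szr rE] := IH; first by move=> x xr; rewrite szP // inE xr orbT.
have sp : size p = n by rewrite szP // mem_head.
split; first by rewrite size_map size_zip sp szr minnn.
rewrite big_cons -rE (nth_map (eis0, eis0)) ?size_zip ?sp ?szr ?minnn //.
rewrite nth_zip ?sp ?szr //= toCD toCM toCX mulrDr; congr (_ + _).
by rewrite hermitian_vec // !mxE mulrCA.
Qed.

Hypothesis prime_q : prime q.
Hypothesis checked : det_check.

(** At an integral point the coordinates of the fields are rational integers, up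
    to the scaling of the columns. *)
Lemma det_orbit_field : \det (\matrix_(i < n, j < n)
  (orbit_field (map vec orb) (nth 0%N ds i) (vec z)) 0 j) != 0.
Proof.
have [/allP im0 inv] := andP checked.
have := det_neq0_inverse_mod prime_q inv.
set M := \matrix_(i, j) _ => M0.
pose f : {rmorphism Z -> C} := (intmul 1 : int -> C) \o int_of_Z.
have -> : \matrix_(i < n, j < n) (orbit_field (map vec orb) (nth 0%N ds i) (vec z)) 0 j
   = map_mx f M *m diag_mx (\row_j sc j).
  apply/matrixP => i j; rewrite mul_mx_diag !mxE -(efieldP _ j).2 mulrC; congr (_ * _).
  set F := [seq efield w orb z n d | d <- ds].
  have iF : (i < size F)%N by rewrite size_map size_ds.
  have FE : nth [::] F i = efield w orb z n (nth 0%N ds i).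
    by rewrite (nth_map 0%N) ?size_ds.
  have sF : size (nth [::] F i) = n by rewrite FE (efieldP _ j).1.
  rewrite (nth_map [::]) // (nth_map eis0) ?sF // -FE.
  have /allP /(_ (nth eis0 (nth [::] F i) j)) := im0 _ (mem_nth [::] iF).
  rewrite mem_nth ?sF // => /(_ isT) /Z.eqb_eq y0.
  by rewrite /toC y0 -[zC 0%Z]/(zC (Z.of_nat 0)) zC_nat mul0r addr0.
rewrite det_mulmx det_map_mx mulf_neq0 //.
  by apply: contra M0 => /eqP fM; apply/eqP/zC_inj; rewrite [LHS]fM /zC /=.
rewrite det_diag prodf_seq_neq0; apply/allP => i _ /=.
by rewrite mxE sc_neq0.
Qed.

Hypothesis gens_pairwise : pairwise (fun a b => ~~ colinear w a b) gens.
Hypothesis size_lines : size L = sumn ds.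
Hypothesis orthogonal_lines : all (fun a =>
  (count (fun b => same_vec [:: eherm w b a] [:: eis0]) L <= N)%N) L.
Hypothesis ds_le : all (fun d => d <= D)%N ds.
Hypothesis gap : (N + 2 * D + 1 < sumn ds)%N.

Theorem root_not_inductively_free : ~ inductively_free
  (reflection_arrangement
     (generated (fun g : 'End(V) => exists2 a, root a & g = refl a))).
Proof.
have sizes := @L_ind (fun=> True) (fun _ _ => I) (fun _ _ _ _ => I).
have pwL : pairwise (fun a b => ~~ colinear w a b) L.
  by rewrite LE; apply: closure_pairwise.
have distinct b c : b \in L -> c \in L -> b != c -> ~~ colinear w b c.
  move=> bL cL ne; have := pairwise_mem pwL bL cL ne.
  have [[sb _ _] [sc' _ _]] := (sizes _ bL, sizes _ cL).
  by rewrite !colinearE // [h (vec c) _ * _]mulrC orbb.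
have injL : {in L &, injective vec}.
  by move=> b c /sizes [sb _ _] /sizes [sc' _ _]; apply: vec_inj.
apply: (@reflection_arrangement_not_inductively_free C n root (map vec orb)
  (map vec L) ds (vec z) N D).
- by move=> a /root_line [].
- exact: root_orbit.
- exact: uniq_orbit.
- exact: size_ds.
- exact: det_orbit_field.
- move=> _ /mapP [b bL ->].
  have := @L_ind (reflection_root root) _ _ _ bL.
  case=> // [g gg|a c]; last exact: reflection_root_refl.
  have [a ra gE] := gens_root gg; split.
    by apply: vec_neq0; have [] := has_norm6P (allP gens_has_norm6 _ gg).
  by rewrite gE; apply: generated_gen; exists a.
- rewrite map_inj_in_uniq // uniq_pairwise.
  apply/(pairwiseP [::]) => i j iL jL ij /=.
  have := pwL => /(pairwiseP [::]) /(_ i j iL jL ij).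
  have [si ni _] := sizes _ (mem_nth [::] iL).
  by apply: contraNneq => <-; rewrite colinearE // ni.
- move=> _ _ /mapP [b bL ->] /mapP [c cL ->] ne.
  have [[sb bb _] [sc' cc _]] := (sizes _ bL, sizes _ cL).
  rewrite bb cc -colinearE //; apply: distinct => //.
  by apply: contraNneq ne => ->.
- by rewrite size_map.
- move=> _ /mapP [a aL ->]; rewrite count_map.
  apply: leq_trans (allP orthogonal_lines _ aL); rewrite leq_eqVlt; apply/orP; left.
  apply/eqP/eq_in_count => b bL; rewrite [LHS]/=.
  have [[sa _ _] [sb _ _]] := (sizes _ aL, sizes _ bL).
  rewrite hermitian_vec // -toC0 (eqtype.inj_eq toC_inj).
  apply/eqP/idP => [->|/same_vecP /(congr1 (head eis0)) //].
  exact/same_vecP.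
- exact: ds_le.
- by rewrite size_map size_lines.
Qed.

End Vectors.
End Concrete.

(** * The groups G_33 and G_34 *)

(** All finite computations for one of the groups.  N bounds the number of roots
    orthogonal to a given one and D the degrees ds of the vector fields, which
    are evaluated at z; p0 is the vector whose orbit defines them. *)
Definition certificate n s w p0 z ds q N D Ninv : bool :=
  let L := root_lines w (base_roots n s) in
  let P := orbit w (base_roots n s) p0 in
  [&& (s.+1 < n)%N, size w == n, size p0 == n, size z == n, size ds == n, prime q,
      all (fun d => d <= D)%N ds, (N + 2 * D + 1 < sumn ds)%N,
      all (has_norm6 n w) (base_roots n s),
      pairwise (fun a b => ~~ colinear w a b) (base_roots n s),
      root_lines_check n s w L, size L == sumn ds,
      all (fun a => (count (fun b => same_vec [:: eherm w b a] [:: eis0]) L <= N)%N) L,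
      stable w (base_roots n s) P & det_check n w z ds q Ninv P].

Definition weights33 : seq Z := [:: 2; 1; 1; 1; 1]%Z.
Definition weights34 : seq Z := [:: 1; 1; 1; 1; 1; 1]%Z.

(** Inverses modulo 41 of the matrices of values of the vector fields. *)
Definition inverse33 : seq (seq Z) :=
  [:: [:: 16; 28; 35; 0; 14];
   [:: 16; 4; 20; 2; 35];
   [:: 13; 4; 22; 20; 24];
   [:: 37; 22; 5; 1; 28];
   [:: 6; 19; 22; 21; 38]]%Z.
Definition inverse34 : seq (seq Z) :=
  [:: [:: 23; 19; 20; 34; 39; 34];
   [:: 12; 22; 17; 37; 2; 39];
   [:: 38; 23; 33; 21; 35; 35];
   [:: 32; 0; 5; 21; 29; 19];
   [:: 19; 25; 37; 5; 12; 23];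
   [:: 1; 23; 15; 39; 17; 31]]%Z.

(** The vector fixed by G(3,3,4) has only its multiples by 1 and -1 in its orbit,
    so it yields fields of the degrees 9 and 15 too; an orbit of roots is stable
    under the sixth roots of unity and yields nonzero fields only in degrees
    congruent to 1 modulo 6. *)
Lemma certificate33 : certificate 5 1 weights33 ((3, 0)%Z :: nseq 4 eis0)
  [seq (x, 0%Z) | x <- [:: -2; -1; 0; 1; 2]%Z] [:: 1; 7; 9; 13; 15]%N 41 12 15
  inverse33.
Proof. by vm_compute. Qed.

Lemma certificate34 : certificate 6 0 weights34 (nseq 6 eis1)
  [seq (x, 0%Z) | x <- [:: -2; -1; 0; 1; 2; 4]%Z] [:: 1; 13; 19; 25; 31; 37]%N 41 45 37
  inverse34.
Proof. by vm_compute. Qed.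

Section Instances.
Variable C : numClosedFieldType.

Lemma certificate_not_inductively_free n s w p0 z ds q N D Ninv (sc : 'I_n -> C)
    (root : 'rV[C]_n -> Prop) :
  certificate n s w p0 z ds q N D Ninv ->
  (forall i, sc i * (sc i)^* = zC C (nth 0%Z w i)) -> (forall i, sc i != 0) ->
  (forall i : 'I_n, (s <= i)%N -> sc i = 1) ->
  (forall a, root a <->
    (exists (i j : 'I_n) k, [/\ (s <= i)%N, (s <= j)%N, i != j &
     a = delta_mx 0 i - omega C ^+ k *: delta_mx 0 j]) \/ a = \row_i sc i) ->
  ~ inductively_free
    (reflection_arrangement (generated (fun g => exists2 a, root a & g = refl a))).
Proof.
move=> ck scM sc0 sc1 rootE.
case/and5P: ck => lt_s /eqP sw /eqP sp /eqP sz /and5P [/eqP sds pq dsD gap].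
case/and5P => n6 pw rl /eqP sL /and3P [orth st dc].
exact: (root_not_inductively_free sw scM sc0 lt_s sc1 rootE n6 (erefl _) rl (erefl _) sp
  st sz sds pq dc pw sL orth dsD gap).
Qed.

Lemma not_inductively_free_G33 : ~ inductively_free (reflection_arrangement (@G33 C)).
Proof.
apply: (certificate_not_inductively_free (sc := fun i => if i == 0 then sqrtC 2 else 1)
          (root := @G33_root C) certificate33).
- have c2 : (sqrtC 2 : C)^* = sqrtC 2 by rewrite conj_Creal // ger0_real // sqrtC_ge0.
  have z1 : zC C 1%Z = 1 := zC_nat C 1.
  case; do 5?[case=> [|]] => //= lti; rewrite ?conjC1 ?mulr1 ?z1 //.
  by rewrite c2 -expr2 sqrtCK (zC_nat C 2).
- by move=> i; case: ifP => _; rewrite ?sqrtC_eq0 ?pnatr_eq0 ?oner_eq0.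
- by move=> i; rewrite lt0n -val_eqE => /negbTE ->.
- by move=> a; split=> -[[i [j [k [i0 j0 ij aE]]]]|aE]; [left|right|left|right] => //;
    exists i, j, k; split; rewrite // ?lt0n // -val_eqE -lt0n.
Qed.

Lemma not_inductively_free_G34 : ~ inductively_free (reflection_arrangement (@G34 C)).
Proof.
apply: (certificate_not_inductively_free (sc := fun=> 1) (root := @G34_root C)
          certificate34).
- have z1 : zC C 1%Z = 1 := zC_nat C 1.
  by case; do 6?[case=> [|]] => //= lti; rewrite conjC1 mulr1 z1.
- by move=> i; apply: oner_neq0.
- by [].
- have cE : const_mx 1 = \row_i 1 :> 'rV[C]_6 by apply/rowP => i; rewrite !mxE.
  move=> a; split=> [[[i [j [k [ij aE]]]]|->]|[[i [j [k [_ _ ij aE]]]]|->]].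
  + by left; exists i, j, k.
  + by right.
  + by left; exists i, j, k.
  + by right.
Qed.

End Instances.

Local Open Scope complex_scope.

Theorem mainTheorem2 (R : realType) :
  ~ inductively_free (reflection_arrangement (@G33 R[i])) /\
  ~ inductively_free (reflection_arrangement (@G34 R[i])).
Proof.
by split; [apply: not_inductively_free_G33|apply: not_inductively_free_G34].
Qed.
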